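(* Let $G$ be a locally finite, connected, infinite graph, and suppose that $\mathrm{Aut}(G)$ has a closed nonunimodular subgroup $\Gamma\subset\mathrm{Aut}(G)$ that acts transitively on (the vertices of) $G$. Then almost surely every tree (connected component) $T$ of the wired uniform spanning forest on $G$ is $\Gamma$-light, i.e. $\sum_{x\in T} m(x)<\infty$.
   Context: $\mathrm{Aut}(G)$ carries the topology of pointwise convergence. For $x\in V(G)$, $\Gamma_x=\{\gamma\in\Gamma:\gamma x=x\}$ and $m(x)=|\Gamma_x|$ is the mass of $\Gamma_x$ under a fixed left Haar measure $|\cdot|$ on $\Gamma$ (unique up to a multiplicative constant). A set $C\subset V(G)$ (or a subgraph with vertex set $C$) is $\Gamma$-light if $m(C):=\sum_{x\in C}m(x)<\infty$ and $\Gamma$-heavy if $m(C)=\infty$. Wired uniform spanning forest (WUSF): let $V_n\uparrow V(G)$ be finite sets such that the induced subgraphs $G_n$ are connected; let $G_n^W$ be obtained from $G$ by identifying all vertices outside $V_n$ to a single vertex and deleting the resulting loops (keeping multiple edges). The WUSF is the weak limit of the uniform spanning tree measures on $G_n^W$ (it exists and does not depend on the exhaustion). *)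

(* Defs.v *)
From HB Require Import structures.
From mathcomp Require Import all_boot all_order all_algebra.
From mathcomp Require Import finmap.
From mathcomp Require Import all_classical all_reals all_analysis.

Set Implicit Arguments.
Unset Strict Implicit.
Unset Printing Implicit Defensive.

Import Order.TTheory GRing.Theory Num.Theory.
Import numFieldNormedType.Exports.

Local Open Scope classical_set_scope.
Local Open Scope ring_scope.

(** Multigraphs with vertices in W and edges in E; [ends a] is the set of
    endpoints of the edge [a], a singleton when [a] is a loop. *)
Record mgraph (W E : choiceType) := MGraph {
  vset : set W;
  eset : set E;
  ends : E -> {fset W} }.

Section Multigraphs.
Context {W E : choiceType}.
Implicit Types (H : mgraph W E) (S : set E) (p : seq (E * W)).

(** [(a1, y1) :: ... :: (ak, yk)] encodes the walk x, a1, y1, ..., ak, yk. *)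
Fixpoint walk H (x : W) p : Prop :=
  if p is (a, y) :: q then
    [/\ eset H a, ends H a = [fset x; y]%fset & walk H y q]
  else True.

Definition joined H (x y : W) : Prop :=
  exists2 p, walk H x p & last x (unzip2 p) = y.

Definition mconnected H : Prop :=
  forall x y, vset H x -> vset H y -> joined H x y.

Definition mcycle H (x : W) p : Prop :=
  [/\ p <> [::], walk H x p, last x (unzip2 p) = x,
      uniq (unzip1 p) & uniq (unzip2 p)].

Definition acyclic H : Prop := forall x p, ~ mcycle H x p.

Definition component H (C : set W) : Prop :=
  exists2 x, vset H x & C = [set y | joined H x y].

Definition spanning H S : mgraph W E := MGraph (vset H) S (ends H).

Definition spanning_tree H S : Prop :=
  [/\ S `<=` eset H, mconnected (spanning H S) & acyclic (spanning H S)].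

End Multigraphs.

(** [e] is meant to be symmetric and irreflexive; an edge is the unordered pair
    of its endpoints. *)
Section SimpleGraphs.
Context {V : choiceType}.
Implicit Types (e : rel V) (U : {fset V}).

Definition edge_set e : set {fset V} :=
  [set a | exists x y, e x y /\ a = [fset x; y]%fset].

Definition edge e : choiceType := set_type (edge_set e).

Definition edge_ends e (a : edge e) : {fset V} := val a.

Definition graph_of e : mgraph V (edge e) :=
  MGraph setT setT (@edge_ends e).

Definition locally_finite e : Prop := forall x, finite_set [set y | e x y].

Definition induced e U : mgraph V (edge e) :=
  MGraph [set` U] [set a | (edge_ends a `<=` U)%fset] (@edge_ends e).

(** [None] is the vertex to which everything outside [U] is identified; edges
    keep their identity (so parallel edges are retained), and those with a
    single endpoint after the identification are the deleted loops. *)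
Definition wire U (x : V) : option V := if x \in U then Some x else None.

Definition wired_ends e U (a : edge e) : {fset option V} :=
  [fset wire U x | x in edge_ends a]%fset.

Definition wired e U : mgraph (option V) (edge e) :=
  MGraph (range (wire U)) [set a | #|` wired_ends U a| = 2%N]
         (@wired_ends e U).

Definition exhaustion e (V_ : nat -> {fset V}) : Prop :=
  [/\ forall n, (V_ n `<=` V_ n.+1)%fset,
      forall x, exists n, x \in V_ n
    & forall n, mconnected (induced e (V_ n))].

End SimpleGraphs.

Definition borel (T : ptopologicalType) := g_sigma_algebraType (@open T).

HB.instance Definition _ (T : ptopologicalType) :=
  Measurable.on (borel T).

(** Sets of edges, with the product topology of {0,1}^E. *)
Definition config (V : choiceType) (e : rel V) : Type :=
  {ptws edge e -> bool}.

HB.instance Definition _ (V : choiceType) (e : rel V) :=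
  Choice.on (config e).
HB.instance Definition _ (V : choiceType) (e : rel V) :=
  Topological.on (config e).
HB.instance Definition _ (V : choiceType) (e : rel V) :=
  isPointed.Build (config e) (fun=> false).

Section Forests.
Context (R : realType).

(** Convergence of the integrals of all bounded continuous functions. *)
Definition weak_cvg (T : ptopologicalType)
    (mu_ : nat -> {measure set (borel T) -> \bar R})
    (mu : {measure set (borel T) -> \bar R}) : Prop :=
  forall f : T -> R, continuous f -> (exists M, forall x, `|f x| <= M) ->
    (fun n => \int[mu_ n]_x (f x)%:E)%E @ \oo --> (\int[mu]_x (f x)%:E)%E.

(** For a finite nonempty [S]; the zero measure otherwise. *)
Definition uniform_measure (T : ptopologicalType) (S : set T) :
    {measure set (borel T) -> \bar R} :=
  let s := fset_set S in
  mscale ((#|` s|%:R : R)^-1)%:nng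
    (msum (fun i => \d_(nth point s i : borel T)) #|` s|).

Context {V : choiceType} (e : rel V).

Definition subforest (w : config e) : mgraph V (edge e) :=
  spanning (graph_of e) [set a | w a].

Definition ust (W : choiceType) (H : mgraph W (edge e)) :
    {measure set (borel (config e)) -> \bar R} :=
  uniform_measure [set w : config e | spanning_tree H [set a | w a]].

Definition is_wusf (P : {measure set (borel (config e)) -> \bar R}) : Prop :=
  exists2 V_, exhaustion e V_ & weak_cvg (fun n => ust (wired e (V_ n))) P.

End Forests.

(** Automorphisms, with the topology of pointwise convergence for the discrete
    topology on the vertices. *)
Definition aut_set (V : choiceType) (e : rel V) :
    set {ptws V -> discrete_topology V} :=
  [set f | bijective f /\ forall x y : V, e (f x) (f y) = e x y].

Definition aut (V : choiceType) (e : rel V) : Type := set_type (aut_set e).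

HB.instance Definition _ (V : choiceType) (e : rel V) := Choice.on (aut e).
HB.instance Definition _ (V : choiceType) (e : rel V) :=
  Topological.on (aut e).

Section AutGroup.
Context {V : choiceType} (e : rel V).

Definition act (g : aut e) (x : V) : V := (val g : V -> V) x.

Fact actP (g : aut e) : aut_set e (val g).
Proof. exact: set_mem (valP g). Qed.

Definition mk_aut (f : V -> V) (ef : aut_set e f) : aut e :=
  exist _ (f : {ptws V -> discrete_topology V}) (mem_set ef).

Fact aut_ext (g h : aut e) : act g =1 act h -> g = h.
Proof. by move=> gh; apply/val_inj/funext. Qed.

Fact aut_one_subproof : aut_set e (@id V).
Proof. by split=> //; exists id. Qed.

Fact aut_mul_subproof (g h : aut e) : aut_set e (act g \o act h).
Proof.
have [bg eg] := actP g; have [bh eh] := actP h; split; first exact: bij_comp.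
by move=> x y; rewrite /= /act eg eh.
Qed.

Fact aut_inv_ex (g : aut e) :
  exists h : V -> V, cancel (act g) h /\ cancel h (act g).
Proof. by have [[h gh hg] _] := actP g; exists h. Qed.

Definition aut_inv_fun (g : aut e) : V -> V := sval (cid (aut_inv_ex g)).

Fact aut_inv_funP (g : aut e) :
  cancel (act g) (aut_inv_fun g) /\ cancel (aut_inv_fun g) (act g).
Proof. exact: svalP (cid (aut_inv_ex g)). Qed.

Fact aut_inv_subproof (g : aut e) : aut_set e (aut_inv_fun g).
Proof.
have [gK Kg] := aut_inv_funP g; have [_ eg] := actP g.
split; first by exists (act g).
by move=> x y; rewrite -eg -![val g _]/(act g _) !Kg.
Qed.

Definition aut_one : aut e := mk_aut aut_one_subproof.
Definition aut_mul (g h : aut e) : aut e := mk_aut (aut_mul_subproof g h).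
Definition aut_inv (g : aut e) : aut e := mk_aut (aut_inv_subproof g).

Fact aut_mulA : associative aut_mul.
Proof. by move=> f g h; apply: aut_ext. Qed.
Fact aut_mul1 : left_id aut_one aut_mul.
Proof. by move=> g; apply: aut_ext. Qed.
Fact aut_mulr1 : right_id aut_one aut_mul.
Proof. by move=> g; apply: aut_ext. Qed.
Fact aut_mulV : left_inverse aut_one aut_inv aut_mul.
Proof. by move=> g; apply: aut_ext => x; exact: (aut_inv_funP g).1. Qed.
Fact aut_mulrV : right_inverse aut_one aut_inv aut_mul.
Proof. by move=> g; apply: aut_ext => x; exact: (aut_inv_funP g).2. Qed.

HB.instance Definition _ := isGroup.Build (aut e)
  aut_mulA aut_mul1 aut_mulr1 aut_mulV aut_mulrV.

End AutGroup.

Record subgroup (G : groupType) := Subgroup {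
  subgroup_set :> set G;
  subgroup_closed : group_closed [pred g | g \in subgroup_set] }.

(** [sub_aut Gam] carries the topology induced by the one on [aut e]. *)
Definition sub_aut (V : choiceType) (e : rel V) (Gam : subgroup (aut e)) :
  Type := set_type Gam.

Section SubAut.
Context {V : choiceType} {e : rel V} (Gam : subgroup (aut e)).

HB.instance Definition _ := Choice.on (sub_aut Gam).
HB.instance Definition _ := SubChoice.on (sub_aut Gam).
HB.instance Definition _ := Topological.on (sub_aut Gam).
HB.instance Definition _ := SubChoice_isSubGroup.Build (aut e)
  (fun g => g \in subgroup_set Gam) (sub_aut Gam) (subgroup_closed Gam).
HB.instance Definition _ := isPointed.Build (sub_aut Gam) 1%g.

Definition transitive_on_vertices : Prop :=
  forall x y : V, exists2 g, subgroup_set Gam g & act g x = y.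

Definition vstab (x : V) : set (sub_aut Gam) :=
  [set g | act (val g) x = x].

Context {R : realType}.
Implicit Types mu : {measure set (borel (sub_aut Gam)) -> \bar R}.

Definition left_invariant mu : Prop :=
  forall (g : sub_aut Gam) (A : set (borel (sub_aut Gam))),
    measurable A -> mu [set (g * h)%g | h in A] = mu A.

Definition right_invariant mu : Prop :=
  forall (g : sub_aut Gam) (A : set (borel (sub_aut Gam))),
    measurable A -> mu [set (h * g)%g | h in A] = mu A.

(** Nonzero left-invariant Radon measures. *)
Definition left_haar mu : Prop :=
  [/\ left_invariant mu,
      mu setT <> 0%E,
      forall K : set (sub_aut Gam), compact K -> (mu K < +oo)%E,
      forall A : set (borel (sub_aut Gam)), measurable A ->
        mu A = ereal_inf [set mu U | U in
                 [set U : set (sub_aut Gam) | open U /\ A `<=` U]]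
    & forall U : set (sub_aut Gam), open U ->
        mu U = ereal_sup [set mu K | K in
                 [set K : set (sub_aut Gam) | compact K /\ K `<=` U]]].

Definition mass mu (x : V) : \bar R := mu (vstab x).

Definition light mu (C : set V) : Prop :=
  (\esum_(x in C) mass mu x < +oo)%E.

End SubAut.

Definition unimodular (R : realType) (V : choiceType) (e : rel V)
    (Gam : subgroup (aut e)) : Prop :=
  exists mu : {measure set (borel (sub_aut Gam)) -> \bar R},
    left_haar mu /\ right_invariant mu.

(* Main.v *)
Require Import Defs.
From mathcomp Require Import all_boot all_order all_algebra.

(** Let [s] be the square root of the mass. The set of the [g] moving [x] to a
    neighbour is a disjoint union of left cosets of the stabilizer of [x], and,
    being invariant under inversion, also one of left cosets of the stabilizers
    of the neighbours; hence the mass is harmonic. It is not constant, as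
    otherwise the Haar measure would be right invariant. By strict concavity of
    the square root and transitivity, the sum of [s] over the neighbours of [x]
    is then at most [psi * s x] with a constant [psi] smaller than the degree
    [d].

    A spanning tree of a finite wired graph amounts to a choice of an out-edge at
    each interior vertex such that all orbits exit. Rerouting a single out-edge
    shows that the number of such forests in which [z] is on the orbit of [v] is
    subharmonic in [v] away from [z]. Summing this against [s] gives, without
    Green functions, that the expected [s]-weight of the orbit of [x] is at most
    [d * s x / (d - psi)], and that, given this orbit, the expected [s]-weight of
    the vertices whose orbits hit it is at most [d / (d - psi)] times its own
    weight (as in Wilson's algorithm, the rest is a uniform forest rooted at the
    orbit and the boundary). So the expected [s]-weight of the cluster of [x] is
    at most [d ^ 2 * s x / (d - psi) ^ 2], uniformly in the exhaustion. In the
    limit [s] is almost surely summable, hence bounded, over each tree, and so is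
    its square. *)

Set Implicit Arguments.
Unset Strict Implicit.
Unset Printing Implicit Defensive.
Import Order.TTheory GRing.Theory Num.Theory.

(** * Rooted forests in a finite graph *)

Section RootedForests.
Context {X : finType}.
Implicit Types (f g : {ffun X -> X}) (U W A : {set X}).

Lemma fconnectP (f : X -> X) (u v : X) :
  reflect (exists n, iter n f u = v) (fconnect f u v).
Proof.
apply: (iffP idP) => [/iter_findex <-|[n <-]]; first by eexists.
exact: fconnect_iter.
Qed.

Lemma fconnect_fixed (f : X -> X) (u v : X) : f u = u -> fconnect f u v -> v = u.
Proof. by move=> fu /fconnectP[n <-]; elim: n => //= n ->. Qed.

Lemma fconnect_step (f : X -> X) (u v : X) :
  fconnect f u v -> v = u \/ fconnect f (f u) v.
Proof.
case/fconnectP=> -[|n] /= <-; first by left.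
by right; rewrite -iterS iterSr fconnect_iter.
Qed.

Variable e : rel X.

(** The functions choosing an out-edge at each vertex of [W], whose orbits all
    leave [W]; vertices outside [W] are roots. *)
Definition forests W : {set {ffun X -> X}} :=
  [set f : {ffun X -> X} | [forall v, (if v \in W then e v (f v) else f v == v) &&
                      [exists u, (u \notin W) && fconnect f v u]]].

Lemma forestsP W f :
  reflect [/\ forall v, v \in W -> e v (f v), forall v, v \notin W -> f v = v
            & forall v, exists2 u, u \notin W & fconnect f v u]
          (f \in forests W).
Proof.
rewrite inE; apply: (iffP forallP) => [h|[h1 h2 h3] v]; last first.
  apply/andP; split; first by case: ifP => [/h1//|/negbT/h2/eqP].
  by have [u uW vu] := h3 v; apply/existsP; exists u; rewrite uW.
split=> v; first by move=> vW; have := h v; rewrite vW => /andP[].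
  by move=> /negbTE vW; have := h v; rewrite vW => /andP[/eqP].
by have /andP[_ /existsP[u /andP[uW vu]]] := h v; exists u.
Qed.

(** On a cycle, the orbit would be back at [v] after every multiple of the period. But once it has
    reached a root outside [W] it stays there. *)
Lemma forests_acyclic W f v : f \in forests W -> v \in W -> ~~ fconnect f (f v) v.
Proof.
move=> /forestsP[_ f_id f_exit] vW; apply/negP => /fconnectP[k vk].
have [u uW /fconnectP[n]] := f_exit v.
have period m : iter (m * k.+1) f v = v.
  by elim: m => // m IH; rewrite mulSn addnC iterD iterSr vk IH.
suff h j : iter j f u = u.
  move=> nu; have : iter (n * k.+1) f v = u.
    by rewrite mulnS addnC iterD nu h.
  by rewrite period => vu; rewrite -vu vW in uW.
by elim: j => //= j ->; exact: f_id.
Qed.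

Definition reroute f (v w : X) : {ffun X -> X} :=
  [ffun u => if u == v then w else f u].

Lemma iter_reroute f v w u n :
  ~~ fconnect f u v -> iter n (reroute f v w) u = iter n f u.
Proof.
move=> uv; elim: n => //= n ->; rewrite ffunE; case: eqP => // h.
by rewrite -h fconnect_iter in uv.
Qed.

Lemma fconnect_reroute f v w u t :
  ~~ fconnect f u v -> fconnect (reroute f v w) u t = fconnect f u t.
Proof.
move=> uv; apply/fconnectP/fconnectP => -[n <-]; exists n.
  by rewrite iter_reroute.
by rewrite iter_reroute.
Qed.

Definition reaching W (z v : X) := [set f in forests W | fconnect f v z].

Lemma in_reaching W z v f :
  (f \in reaching W z v) = (f \in forests W) && fconnect f v z.
Proof. by rewrite [LHS]inE. Qed.

(** The orbit of [w] avoids [v], as it would otherwise reach [z] through [v]; that of [f v] avoids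
    [v] by acyclicity. Hence rerouting at [v] changes neither of them. *)
Lemma reaching_reroute W z v w f : v \in W -> v != z -> e v w ->
  f \in reaching W z v :\: reaching W z w ->
  reroute f v w \in reaching W z (f v) :\: reaching W z v.
Proof.
move=> vW vz evw; rewrite !in_setD !in_reaching => /andP[wz /andP[fF vcz]].
rewrite fF /= in wz.
have [f_e f_id f_exit] := forestsP _ _ fF.
have wv : ~~ fconnect f w v.
  by apply: contra wz => wv; exact: connect_trans wv vcz.
have fvv := forests_acyclic fF vW.
have fvz : fconnect f (f v) z.
  by case: (fconnect_step vcz) vz => // ->; rewrite eqxx.
set f' := reroute f v w.
have f'v : f' v = w by rewrite ffunE eqxx.
have vz' : ~~ fconnect f' v z.
  apply/negP => /fconnect_step[zv|]; first by rewrite zv eqxx in vz.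
  by rewrite f'v fconnect_reroute // (negPf wz).
have f'F : f' \in forests W.
  apply/forestsP; split=> u.
  - by move=> uW; rewrite ffunE; case: eqP => [->//|_]; exact: f_e.
  - by move=> uW; rewrite ffunE; case: eqP => [uv|_]; [rewrite uv vW in uW|exact: f_id].
  - have [r rW wr] := f_exit w.
    (* Orbits through [v] now continue to [w] and on to its root [r]; the others do not change. *)
    have [|uv] := boolP (fconnect f u v); last first.
      by have [t tW ut] := f_exit u; exists t; rewrite ?fconnect_reroute.
    move=> /fconnectP[n]; elim: n u => [u /= ->|n IH u].
      exists r => //; apply: connect_trans (fconnect1 _ _) _.
      by rewrite f'v fconnect_reroute.
    rewrite iterSr => un; have [t tW ft] := IH _ un.
    have [->|uv] := eqVneq u v.
      exists r => //; apply: connect_trans (fconnect1 _ _) _.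
      by rewrite f'v fconnect_reroute.
    exists t => //; apply: connect_trans ft.
    by have := fconnect1 f' u; rewrite {2}/f' ffunE (negPf uv).
rewrite f'F (negPf vz') /=.
by rewrite fconnect_reroute.
Qed.

(** This turns a sum over out-neighbours into a number of pairs of a forest and a vertex, so that
    two such sums can be compared by an injection. *)
Lemma card_sum_pairs (T : finType) (P : pred X) (S : X -> {set T}) :
  \sum_(w | P w) #|S w| = #|[set p : T * X | P p.2 && (p.1 \in S p.2)]|.
Proof.
rewrite -sum1_card (reindex (fun p : X * T => (p.2, p.1))) /=; last first.
  by exists (fun p => (p.2, p.1)) => -[].
rewrite (eq_bigl (fun p : X * T => P p.1 && (p.2 \in S p.1))); last by move=> ?; rewrite inE.
rewrite -(pair_big_dep P (fun w t => t \in S w) (fun _ _ => 1%N)) /=.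
by apply: eq_bigr => w _; rewrite sum1_card.
Qed.

(* Rerouting [v] along the edge to [w] turns a forest in which [z] is reached
   from [v] but not from [w] into one in which [z] is reached from the former
   image of [v] but not from [v]. *)
Lemma reaching_subharmonic W z v : v \in W -> v != z ->
  #|[pred w | e v w]| * #|reaching W z v| <= \sum_(w | e v w) #|reaching W z w|.
Proof.
move=> vW vz; rewrite -sum_nat_const.
under eq_bigr => w _ do rewrite -(cardsID (reaching W z w)).
under [leqRHS]eq_bigr => w _ do rewrite -(cardsID (reaching W z v)) setIC.
rewrite !big_split leq_add2l !card_sum_pairs.
(* The second component records the old image of [v], so [t] undoes itself. *)
pose t (p : {ffun X -> X} * X) := (reroute p.1 v p.2, p.1 v).
have tK : involutive t.
  move=> [f w]; rewrite /t /= ffunE eqxx; congr pair.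
  by apply/ffunP => u; rewrite !ffunE; case: eqP => // ->.
rewrite -(card_imset _ (inv_inj tK)); apply/subset_leq_card/subsetP.
move=> q /imsetP[[f w] + ->]; rewrite inE /= => /andP[evw fin].
rewrite inE /= (reaching_reroute vW vz evw fin) andbT.
by move: fin; rewrite in_setD !in_reaching => /andP[_ /andP[/forestsP[/(_ _ vW)]]].
Qed.

Lemma reaching_root W z : #|reaching W z z| = #|forests W|.
Proof. by apply: eq_card => f; rewrite in_reaching connect0 andbT. Qed.

Lemma reaching_out W z v : v \notin W -> v != z -> #|reaching W z v| = 0.
Proof.
move=> vW vz; apply/eqP; rewrite cards_eq0; apply/eqP/setP => f.
rewrite in_reaching in_set0; apply/negP => /andP[/forestsP[_ /(_ v vW) fv _]].
by move=> /(fconnect_fixed fv) zv; rewrite zv eqxx in vz.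
Qed.

(** * Forests with a prescribed orbit *)

Definition restr W f : {ffun X -> X} := [ffun v => if v \in W then f v else v].

Definition glue W f g : {ffun X -> X} := [ffun v => if v \in W then g v else f v].

(** The restricted orbit follows that of [f] up to its first vertex outside [W], where it stops. *)
Lemma restr_forests W U f : W \subset U -> f \in forests U -> restr W f \in forests W.
Proof.
move=> WU /forestsP[f_e f_id f_exit]; apply/forestsP; split=> v.
- by move=> vW; rewrite ffunE vW f_e // (subsetP WU).
- by move=> /negbTE vW; rewrite ffunE vW.
- have [u uU /fconnectP[n nu]] := f_exit v.
  elim: n v nu => [/= v vu|n IH v].
    by exists v; [rewrite vu; apply: contra uU; exact: (subsetP WU)|exact: connect0].
  have [vW|vW _] := boolP (v \in W); last by exists v => //; exact: connect0.
  rewrite iterSr => /IH[t tW ft]; exists t => //; apply: connect_trans ft.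
  by have := fconnect1 (restr W f) v; rewrite {2}/restr ffunE vW.
Qed.

Lemma fconnect_substep f g u v : (forall w, g w = w \/ g w = f w) ->
  fconnect g u v -> fconnect f u v.
Proof.
move=> gf /fconnectP[n <-]; elim: n => [|n IH] /=; first exact: connect0.
case: (gf (iter n g u)) => ->; first exact: IH.
exact: connect_trans IH (fconnect1 _ _).
Qed.

Definition trunk W (x : X) f := [set v in W | fconnect f x v].

Lemma iter_trunk U x f f' n : f \in forests U ->
  {in trunk U x f, f' =1 f} -> {in ~: U, f' =1 f} -> iter n f' x = iter n f x.
Proof.
move=> fF ff'1 ff'2; elim: n => //= n ->.
have [nU|nU] := boolP (iter n f x \in U).
  by apply: ff'1; rewrite inE nU fconnect_iter.
by apply: ff'2; rewrite inE.
Qed.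

Lemma eq_trunk U x f f' : f \in forests U ->
  {in trunk U x f, f' =1 f} -> {in ~: U, f' =1 f} -> trunk U x f' = trunk U x f.
Proof.
move=> fF h1 h2; apply/setP => v; rewrite !inE; congr andb.
have E n : iter n f' x = iter n f x by exact: iter_trunk fF h1 h2.
by apply/fconnectP/fconnectP => -[n <-]; exists n; rewrite E.
Qed.

(** An orbit follows [g] until it leaves [U] or hits the trunk; from the trunk it follows the orbit
    of [x] under [f], which exits. *)
Lemma glue_forests U x f g : f \in forests U -> g \in forests (U :\: trunk U x f) ->
  glue (U :\: trunk U x f) f g \in forests U.
Proof.
move=> fF gF; set A := trunk U x f; set W := U :\: A in gF *.
have [f_e f_id f_exit] := forestsP _ _ fF.
have [g_e g_id g_exit] := forestsP _ _ gF.
set h := glue W f g.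
have hA : {in A, h =1 f} by move=> v vA; rewrite ffunE inE vA.
have hU : {in ~: U, h =1 f}.
  by move=> v; rewrite inE => vU; rewrite ffunE inE (negPf vU) andbF.
apply/forestsP; split=> v.
- move=> vU; rewrite ffunE; case: ifP => [vW|_]; [exact: g_e|exact: f_e].
- by move=> vU; rewrite hU ?inE // f_id.
- have [u uW vu] := g_exit v.
  have {}vu : fconnect h v u.
    apply: fconnect_substep vu => w; rewrite ffunE.
    by case: ifP => [_|/negbT/g_id ->]; [right|left].
  have [uU|uU] := boolP (u \in U); last by exists u.
  have : u \in A by move: uW; rewrite inE uU andbT negbK.
  rewrite inE => /andP[_ /fconnectP[k ku]].
  have [t tU /fconnectP[j jt]] := f_exit u.
  exists t => //; apply: connect_trans vu _; apply/fconnectP; exists j.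
  by rewrite -jt -ku -[RHS]iterD -(iter_trunk (j + k) fF hA hU) iterD (iter_trunk k fF hA hU).
Qed.

Definition same_trunk U x f : {set {ffun X -> X}} :=
  [set f' in forests U | (trunk U x f' == trunk U x f) &&
                         [forall v in trunk U x f, f' v == f v]].

(** Restriction to the complement of the trunk inverts gluing: on the trunk the forests agree with
    [f] by definition, and outside [U] all are the identity. *)
Lemma same_trunkE U x f : f \in forests U ->
  same_trunk U x f =
  [set glue (U :\: trunk U x f) f g | g in forests (U :\: trunk U x f)].
Proof.
move=> fF; set A := trunk U x f; set W := U :\: A.
have [f_e f_id f_exit] := forestsP _ _ fF.
apply/setP => f'; apply/idP/imsetP => [|[g gF ->]].
  rewrite inE => /and3P[f'F _ /forall_inP f'A].
  exists (restr W f'); first exact: restr_forests (subsetDl _ _) f'F.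
  apply/ffunP => v; rewrite !ffunE; case: ifP => vW; first by rewrite vW.
  have [vA|vA] := boolP (v \in A); first by rewrite (eqP (f'A v vA)).
  have vU : v \notin U by move: vW; rewrite inE vA /= => ->.
  by have [_ /(_ v vU) -> _] := forestsP _ _ f'F; rewrite f_id.
have hA : {in A, glue W f g =1 f} by move=> v vA; rewrite ffunE inE vA.
rewrite inE (glue_forests fF gF) /=; apply/andP; split; last first.
  by apply/forall_inP => v vA; rewrite hA.
apply/eqP; apply: eq_trunk => // v.
by rewrite inE => vU; rewrite ffunE inE (negPf vU) andbF.
Qed.

Lemma glue_inj U x f : f \in forests U ->
  {in forests (U :\: trunk U x f) &, injective (glue (U :\: trunk U x f) f)}.
Proof.
move=> fF g g' /forestsP[_ g_id _] /forestsP[_ g'_id _] gg'.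
apply/ffunP => v; have := congr1 (fun h : {ffun X -> X} => h v) gg'.
by rewrite !ffunE; case: ifP => // /negbT vW _; rewrite g_id ?g'_id.
Qed.

(** The meeting point must lie in [U]: orbits that share nothing but a root outside [U] do not
    coalesce. *)
Definition coalesce U x f (y : X) :=
  [exists z in U, fconnect f x z && fconnect f y z].

(** The glued forest has the same trunk as [f], so the orbits meet on it. Up to its first vertex on
    the trunk, the orbit of [y] is an orbit of [g]. *)
Lemma coalesce_glue U x f g y :
  f \in forests U -> g \in forests (U :\: trunk U x f) -> y \in U ->
  coalesce U x (glue (U :\: trunk U x f) f g) y ->
  exists2 z, z \in trunk U x f & (y \in z |: (U :\: trunk U x f)) && fconnect g y z.
Proof.
move=> fF gF yU; set A := trunk U x f; set W := U :\: A.
have hF := glue_forests fF gF.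
have [_ f_id _] := forestsP _ _ fF.
move=> /existsP[z /and3P[zU xz yz]].
have zA : z \in A.
  have hA : {in A, glue W f g =1 f} by move=> v vA; rewrite ffunE inE vA.
  have hU : {in ~: U, glue W f g =1 f}.
    by move=> v; rewrite inE => vU; rewrite ffunE inE (negPf vU) andbF.
  by rewrite -[A](eq_trunk fF hA hU) inE zU.
case/fconnectP: yz => n; elim: n y yU => [|n IH] y yU.
  by move=> /= ->; exists z => //; rewrite !inE eqxx connect0.
have [yA _|yA] := boolP (y \in A); first by exists y; rewrite // !inE eqxx connect0.
have yW : y \in W by rewrite inE yA.
rewrite iterSr ffunE yW => gz.
have [gyU|gyU] := boolP (g y \in U).
  have [t tA /andP[_ gt]] := IH _ gyU gz; exists t => //.
  by rewrite inE yW orbT; exact: connect_trans (fconnect1 _ _) gt.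
(* Having left [U], the orbit would be stuck and could not reach [z]. *)
have fix_gy : iter n (glue W f g) (g y) = g y.
  by elim: {gz IH} n => //= n ->; rewrite ffunE inE (negPf gyU) andbF f_id.
by rewrite -gz fix_gy (negPf gyU) in zU.
Qed.

(** * Counts of forests against an excessive weight *)

Section Weights.
Local Open Scope ring_scope.
Context {R : realFieldType} (s : X -> R) (d : nat) (psi : R) (U : {set X}).
Hypothesis e_sym : symmetric e.
Hypothesis s_ge0 : forall v, 0 <= s v.
Hypothesis s_gt0 : forall v, v \in U -> 0 < s v.
Hypothesis degU : forall v, v \in U -> #|[pred w | e v w]| = d.
Hypothesis s_exc : forall v, v \in U -> \sum_(w | e v w) s w <= psi * s v.
Hypothesis psi_d : psi < d%:R.

Lemma reaching_subharmonicR W z v : W \subset U -> v \in W -> v != z ->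
  d%:R * #|reaching W z v|%:R <= \sum_(w | e v w) #|reaching W z w|%:R :> R.
Proof.
move=> WU vW vz; rewrite -natrM -natr_sum ler_nat.
rewrite -(degU (subsetP WU _ vW)); exact: reaching_subharmonic.
Qed.

(** Multiply subharmonicity at each [v] other than [z] by [s v], sum, and exchange the sums: the
    count at [w] then carries at most the [s]-weight of the neighbours of [w], that is [psi * s w].
    The term [v = z], where subharmonicity may fail, gives the right-hand side. *)
Lemma sum_reaching_source W z : W \subset U -> z \in U ->
  (d%:R - psi) * \sum_(v in z |: W) s v * #|reaching W z v|%:R
    <= d%:R * s z * #|forests W|%:R.
Proof.
move=> WU zU; pose a v : R := #|reaching W z v|%:R.
rewrite mulrBl lerBlDr {1}(bigD1 z) ?setU11 //= mulrDr reaching_root mulrA.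
rewrite lerD2l.
have in_zW v : (v \in z |: W) && (v != z) = (v \in W) && (v != z).
  by rewrite in_setU1; case: (v == z); rewrite ?andbF ?andbT.
rewrite (eq_bigl _ _ in_zW) mulr_sumr.
apply: (@le_trans _ _ (\sum_(v | (v \in W) && (v != z)) \sum_(w | e v w) s v * a w)).
  apply: ler_sum => v /andP[vW vz]; rewrite mulrCA -mulr_sumr ler_wpM2l //.
  exact: reaching_subharmonicR.
rewrite (exchange_big_dep predT) //= (bigID (mem (z |: W))) /=.
rewrite [X in _ + X]big1 ?addr0; last first.
  move=> w wzW; apply: big1 => v _; rewrite /a reaching_out ?mulr0 //.
    by apply: contra wzW => wW; rewrite inE wW orbT.
  by apply: contra wzW => /eqP ->; rewrite setU11.
rewrite mulr_sumr; apply: ler_sum => w wzW.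
have wU : w \in U by move: wzW; rewrite /= in_setU1 => /orP[/eqP -> //|/(subsetP WU)].
rewrite -mulr_suml mulrA ler_wpM2r ?ler0n //.
apply: le_trans (s_exc wU).
rewrite [leRHS](bigID (fun v => (v \in W) && (v != z))) /=.
rewrite (eq_bigl (fun v => e w v && ((v \in W) && (v != z)))); last first.
  by move=> v; rewrite /= andbC e_sym.
by rewrite lerDl sumr_ge0.
Qed.

(** A maximum principle: let [B v] be the total [s]-weight of the orbits of [v]. At a vertex
    maximizing [B v / s v], with maximum [c], the inequality [Bstep] and excessivity give
    [(d - psi) * c <= d * #|forests U|]. *)
Lemma sum_reaching_target x : x \in U ->
  (d%:R - psi) * \sum_(z in U) s z * #|reaching U z x|%:R
    <= d%:R * s x * #|forests U|%:R.
Proof.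
move=> xU; pose B v : R := \sum_(z in U) s z * #|reaching U z v|%:R.
have d_gt0 : 0 < d%:R - psi by rewrite subr_gt0.
have B_ge0 v : 0 <= B v by apply: sumr_ge0 => z _; rewrite mulr_ge0.
have Bstep v : v \in U ->
    d%:R * B v <= d%:R * s v * #|forests U|%:R + \sum_(w | e v w) B w.
  move=> vU; rewrite {1}/B (bigD1 v) //= reaching_root mulrDr mulrA lerD2l.
  rewrite exchange_big /= [leRHS](bigD1 v) //= -[leLHS]add0r lerD //.
    by apply: sumr_ge0 => w _; rewrite mulr_ge0.
  rewrite mulr_sumr; apply: ler_sum => z /andP[zU zv].
  rewrite mulrCA -mulr_sumr ler_wpM2l //.
  by apply: reaching_subharmonicR => //; rewrite eq_sym.
have B_out w : w \notin U -> B w = 0.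
  move=> wU; apply: big1 => z zU; rewrite reaching_out ?mulr0 //.
  by apply: contraNneq wU => ->.
case: (arg_maxP (fun v => B v / s v) xU) => v vU vmax.
set c := B v / s v in vmax.
have c_ge0 : 0 <= c by rewrite divr_ge0.
have Bv : c * s v = B v by rewrite mulfVK // gt_eqF ?s_gt0.
clearbody c.
have B_le w : B w <= c * s w.
  have [wU|wU] := boolP (w \in U); last by rewrite B_out // mulr_ge0.
  by rewrite -ler_pdivrMr ?s_gt0 //; exact: vmax.
have c_le : (d%:R - psi) * c <= d%:R * #|forests U|%:R.
  rewrite -(ler_pM2r (s_gt0 vU)) mulrBl mulrBl lerBlDr.
  rewrite -mulrA Bv mulrAC; apply: le_trans (Bstep v vU) _.
  rewrite lerD2l; apply: (@le_trans _ _ (\sum_(w | e v w) c * s w)).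
    exact: ler_sum.
  by rewrite -mulr_sumr [psi * c]mulrC -mulrA ler_wpM2l // s_exc.
rewrite [leRHS]mulrAC; apply: (@le_trans _ _ ((d%:R - psi) * (c * s x))).
  by rewrite ler_wpM2l ?(ltW d_gt0) // B_le.
by rewrite mulrA ler_wpM2r.
Qed.

(* Given the orbit of [x], the rest of the forest is uniform in the complement
   of this orbit. *)
Lemma sum_same_trunk x f : f \in forests U ->
  (d%:R - psi) *
    \sum_(f' in same_trunk U x f) \sum_(y in U | coalesce U x f' y) s y
  <= d%:R * \sum_(f' in same_trunk U x f) \sum_(z in trunk U x f') s z.
Proof.
move=> fF; set A := trunk U x f; set W := U :\: A.
have d_gt0 : 0 < d%:R - psi by rewrite subr_gt0.
have AU z : z \in A -> z \in U by rewrite inE => /andP[].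
rewrite [X in _ <= _ * X](_ : _ = \sum_(z in A) s z * #|forests W|%:R); last first.
  rewrite (eq_bigr (fun=> \sum_(z in A) s z)); last first.
    by move=> f'; rewrite inE => /and3P[_ /eqP -> _].
  rewrite sumr_const (same_trunkE _ fF) card_in_imset; last exact: glue_inj.
  by rewrite -mulr_suml mulr_natr.
rewrite (same_trunkE _ fF) big_imset /=; last exact: glue_inj.
(* A union bound over the trunk vertices [z] at which the orbit of [y] may arrive;
   [sum_reaching_source] then treats each [z]. *)
apply: (@le_trans _ _ ((d%:R - psi) * \sum_(g in forests W)
    \sum_(z in A) \sum_(y in z |: W | fconnect g y z) s y)).
  rewrite ler_wpM2l ?(ltW d_gt0) //; apply: ler_sum => g gF.
  rewrite (exchange_big_dep predT) //= [leRHS](bigID (fun y => (y \in U) &&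
    coalesce U x (glue W f g) y)) /= -[leLHS]addr0 lerD //; last first.
    by apply: sumr_ge0 => y _; apply: sumr_ge0 => z _.
  apply: ler_sum => y /andP[yU /(coalesce_glue fF gF yU)[z zA yz]].
  by rewrite (bigD1 z) /= ?zA // lerDl sumr_ge0.
rewrite exchange_big /= !mulr_sumr; apply: ler_sum => z zA; rewrite mulrA.
apply: le_trans (sum_reaching_source (subsetDl U A) (AU _ zA)).
rewrite ler_wpM2l ?(ltW d_gt0) // (exchange_big_dep (mem (z |: W))) /=; last first.
  by move=> g y _ /andP[].
apply: ler_sum => y yzW.
rewrite (eq_bigl (mem (reaching W z y))) ?sumr_const ?mulr_natr // => g.
by rewrite !inE; move: yzW; rewrite !inE => ->.
Qed.

(** One factor [d / (d - psi)] passes from the cluster to the trunk, class by class; the other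
    bounds the trunk by [sum_reaching_target]. *)
Lemma sum_coalesce x : x \in U ->
  (d%:R - psi) ^+ 2 *
    \sum_(f in forests U) \sum_(y in U | coalesce U x f y) s y
  <= d%:R ^+ 2 * s x * #|forests U|%:R.
Proof.
move=> xU; have d_gt0 : 0 < d%:R - psi by rewrite subr_gt0.
(* The fibres of [key] are the classes [same_trunk U x f]. *)
pose key f : {set X} * {ffun X -> X} := (trunk U x f, restr (trunk U x f) f).
have fiber f : f \in forests U ->
    forall f', (f' \in forests U) && (key f' == key f) = (f' \in same_trunk U x f).
  move=> fF f'; rewrite [RHS]inE; congr andb; apply/eqP/andP => [[-> E]|[/eqP E h]].
    split=> //; apply/forall_inP => v vA; have := congr1 (fun h : {ffun X -> X} => h v) E.
    by rewrite !ffunE vA => ->.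
  rewrite /key E; congr pair; apply/ffunP => v; rewrite !ffunE.
  by case: ifP => // vA; rewrite (eqP (forall_inP h v vA)).
have class : (d%:R - psi) *
    \sum_(f in forests U) \sum_(y in U | coalesce U x f y) s y
    <= d%:R * \sum_(f in forests U) \sum_(z in trunk U x f) s z.
  rewrite !(partition_big key (mem (key @: forests U))) /=;
    try by move=> f fF; exact: imset_f.
  rewrite !mulr_sumr; apply: ler_sum => _ /imsetP[f fF ->].
  by rewrite !(eq_bigl _ _ (fiber f fF)); exact: sum_same_trunk.
rewrite expr2 -mulrA.
apply: le_trans (_ : _ <= (d%:R - psi) * (d%:R *
    \sum_(f in forests U) \sum_(z in trunk U x f) s z)) _.
  by rewrite ler_wpM2l ?(ltW d_gt0).
rewrite mulrCA expr2 -!mulrA ler_wpM2l // mulrA.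
apply: le_trans (sum_reaching_target xU); rewrite ler_wpM2l ?(ltW d_gt0) //.
rewrite (exchange_big_dep (mem U)) /=; last by move=> f z _; rewrite inE => /andP[].
apply: ler_sum => z zU.
rewrite (eq_bigl (mem (reaching U z x))) ?sumr_const ?mulr_natr // => f.
by rewrite !inE zU.
Qed.

End Weights.
End RootedForests.

From mathcomp Require Import finmap.
From mathcomp Require Import all_classical all_reals all_analysis.
From mathcomp Require Import measurable_realfun.
Import numFieldNormedType.Exports.
Local Open Scope classical_set_scope.

(** * Spanning trees of wired graphs *)

Section Walks.
Context {W E : choiceType}.
Implicit Types (H : mgraph W E) (p q : seq (E * W)) (S : set E).

Lemma walk_cat H x p q :
  walk H x (p ++ q) <-> walk H x p /\ walk H (last x (unzip2 p)) q.
Proof.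
elim: p x => [|[a y] p IH] x /=; first by split=> [|[]].
split=> [[? ? /IH[? ?]]|[[? ? ?] ?]]; first by [].
by split=> //; apply/IH.
Qed.

Lemma joined_refl H x : joined H x x.
Proof. by exists [::]. Qed.

Lemma joined_trans H y x z : joined H x y -> joined H y z -> joined H x z.
Proof.
move=> [p xp py] [q yq qz]; exists (p ++ q); first by apply/walk_cat; rewrite py.
by rewrite /unzip2 map_cat last_cat py.
Qed.

Lemma joined_edge H a x y : eset H a -> ends H a = [fset x; y]%fset -> joined H x y.
Proof. by move=> aH axy; exists [:: (a, y)]. Qed.

Lemma joined_sym H x y : joined H x y -> joined H y x.
Proof.
case=> p; elim: p x => [|[a z] p IH] x /=; first by move=> _ ->; exact: joined_refl.
move=> [aH axz zp] py; apply: joined_trans (IH _ zp py) _.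
by apply: (joined_edge aH); rewrite axz fsetUC.
Qed.

Lemma walk_ends H x p a u : walk H x p -> a \in unzip1 p -> u \in ends H a ->
  u \in x :: unzip2 p.
Proof.
elim: p x => // -[b y] p IH x /= [_ bxy yp]; rewrite in_cons => /orP[/eqP ->|ap ua].
  by rewrite bxy !inE => /orP[]/eqP ->; rewrite eqxx ?orbT.
by rewrite in_cons (IH _ yp ap ua) orbT.
Qed.

Lemma walk_edges H x p a : walk H x p -> a \in unzip1 p -> eset H a.
Proof.
by elim: p x => // -[b y] p IH x /= [bH _ /IH h]; rewrite in_cons => /orP[/eqP ->|/h].
Qed.

(** A repetition of the first edge would bring the walk back to its endpoint [x]. *)
Lemma simple_walk_uniq_edges H x p :
  walk H x p -> uniq (x :: unzip2 p) -> uniq (unzip1 p).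
Proof.
elim: p x => // -[a y] p IH x [_ axy yp] /andP[xyp yp_uniq].
rewrite [unzip1 _]/= cons_uniq (IH _ yp yp_uniq) andbT; apply/negP => ap.
by move/negP: xyp; apply; apply: (walk_ends yp ap); rewrite axy !inE eqxx.
Qed.

Lemma walk_sub H H' x p : ends H = ends H' -> {subset eset H <= eset H'} ->
  walk H x p -> walk H' x p.
Proof.
move=> endsE sub; elim: p x => // -[a y] p IH x /= [aH axy /IH yp]; split=> //.
  exact/set_mem/sub/mem_set.
by rewrite -endsE.
Qed.

Lemma simple_walk H x y : joined H x y ->
  exists p, [/\ walk H x p, last x (unzip2 p) = y & uniq (x :: unzip2 p)].
Proof.
case=> p; elim: p x => [|[a z] p IH] x /=; first by move=> _ <-; exists [::].
move=> [aH axz zp] py; have [q [zq qy q_uniq]] := IH _ zp py.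
have [xq|xq] := boolP (x \in z :: unzip2 q); last first.
  by exists ((a, z) :: q); split=> //; rewrite /= [X in X && _]xq.
(* If the simple walk from [z] already visits [x], its part after that visit suffices. *)
suff cut s u : walk H u s -> x \in u :: unzip2 s -> uniq (u :: unzip2 s) ->
    exists t, [/\ walk H x t, last x (unzip2 t) = last u (unzip2 s) & uniq (x :: unzip2 t)].
  by have [t [xt tE t_uniq]] := cut _ _ zq xq q_uniq; exists t; rewrite tE.
elim: s u => [u _|[b v] s IHs u us].
  by rewrite inE => /eqP <- _; exists [::].
rewrite in_cons => /orP[/eqP ->|xs us_uniq]; first by exists ((b, v) :: s).
by case: us => _ _ vs; apply: IHs vs xs _; case/andP: us_uniq.
Qed.

End Walks.

(** A spanning subgraph in which every edge is of the form [pe s], joining [s] to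
    a vertex of smaller rank. *)
Section RankedForest.
Context {W E : choiceType} (H : mgraph W E) (S : set E).
Context (pe : W -> option E) (rk : W -> nat).
Hypothesis S_pe : forall a s t, S a -> ends H a = [fset s; t]%fset ->
  pe s = Some a \/ pe t = Some a.
Hypothesis pe_rk : forall a s t, pe s = Some a -> ends H a = [fset s; t]%fset ->
  rk s = (rk t).+1.
Hypothesis pe_ends : forall a s, pe s = Some a -> s \in ends H a.
Local Notation HS := (spanning H S).

(** An edge that is not the parent edge of its start is that of its end, so the rank goes up by one;
    as edges do not repeat, the next edge is again not the parent edge of its start. *)
Lemma climbing_walk s p : walk HS s p -> uniq (unzip1 p) ->
  pe s \notin [seq Some a | a <- unzip1 p] ->
  rk (last s (unzip2 p)) = rk s + size p.
Proof.
elim: p s => [s|[a t] p IH s]; first by rewrite addn0.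
move=> [Sa ast tp] /= /andP[ap p_uniq]; rewrite in_cons negb_or => /andP[sa _].
have ta : pe t = Some a by case: (S_pe Sa ast) sa => [->|-> //]; rewrite eqxx.
rewrite (IH _ tp p_uniq) ?ta ?mem_map //.
by rewrite addnS -addSn -(@pe_rk a t s) // ast fsetUC.
Qed.

(** The same argument, reading the walk backwards. *)
Lemma descending_walk s p : walk HS s p -> uniq (unzip1 p) ->
  pe (last s (unzip2 p)) \notin [seq Some a | a <- unzip1 p] ->
  rk s = rk (last s (unzip2 p)) + size p.
Proof.
elim/last_ind: p => [|p [a t] IH]; first by rewrite addn0.
move=> w; have {w} : walk HS s (p ++ [:: (a, t)]) by rewrite cats1.
move=> /walk_cat[sp [Sa aut _]].
rewrite /unzip1 /unzip2 !map_rcons rcons_uniq last_rcons mem_rcons in_cons.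
rewrite negb_or size_rcons => /andP[ap p_uniq] /andP[ta _].
set u := last s _ in sp aut *.
have ua : pe u = Some a by case: (S_pe Sa aut) ta => [-> //|->]; rewrite eqxx.
rewrite (IH sp p_uniq) -/u ?ua ?mem_map //.
by rewrite (pe_rk ua aut) addSnnS.
Qed.

Lemma ranked_acyclic : acyclic HS.
Proof.
move=> x p [p0 xp px p_uniq1 p_uniq2].
have [|xin] := boolP (pe x \in [seq Some a | a <- unzip1 p]); last first.
  have := climbing_walk xp p_uniq1 xin; rewrite px => /eqP.
  by rewrite -{1}[rk x]addn0 eqn_add2l eq_sym size_eq0 => /eqP.
move=> /mapP[a + xa]; move=> /mapP[[b y] bp /= ab]; subst b.
case/splitPr: bp p0 xp px p_uniq1 p_uniq2 => p1 p2 _ /walk_cat[xp1].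
set s := last x (unzip2 p1) => -[Sa asy yp2].
rewrite /unzip1 /unzip2 !map_cat /= last_cat /= => px.
rewrite !cat_uniq /= => /and3P[p1_uniq1 p1a /andP[ap2 p2_uniq1]].
move=> /and3P[p1_uniq2 p1y /andP[yp2' p2_uniq2]].
(* The cycle uses the parent edge [a] of [x]. If [a] leaves [x], the rest descends to [x] from the
   parent; if [a] arrives at [x], the part before it climbs from [x] to the parent. Either way the
   parent has rank at least that of [x]. *)
have := pe_ends xa; rewrite asy !inE => /orP[]/eqP xE.
  have := descending_walk yp2 p2_uniq1; rewrite px xa mem_map; last by move=> ? ? [].
  move=> /(_ ap2) rky; rewrite -xE in asy; have := pe_rk xa asy; rewrite rky => /eqP.
  by rewrite -addnS -{1}[rk x]addn0 eqn_add2l.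
subst y; have sx := climbing_walk xp1 p1_uniq1.
rewrite xa mem_map in sx; last by move=> ? ? [].
have ap1 : a \notin unzip1 p1 by move: p1a; rewrite negb_or => /andP[].
have := pe_rk xa (etrans asy (fsetUC _ _)); rewrite /s (sx ap1) => /eqP.
by rewrite -addnS -{1}[rk x]addn0 eqn_add2l.
Qed.

End RankedForest.

Lemma fset2_eq (T : choiceType) (a b c d : T) : [fset a; b]%fset = [fset c; d]%fset ->
  (a = c /\ b = d) \/ (a = d /\ b = c).
Proof.
move=> abcd.
have a_in : a \in [fset c; d]%fset by rewrite -abcd !inE eqxx.
have b_in : b \in [fset c; d]%fset by rewrite -abcd !inE eqxx orbT.
have c_in : c \in [fset a; b]%fset by rewrite abcd !inE eqxx.
have d_in : d \in [fset a; b]%fset by rewrite abcd !inE eqxx orbT.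
move: a_in b_in c_in d_in; rewrite !inE.
by move=> /orP[]/eqP-> /orP[]/eqP-> /orP[]/eqP ? /orP[]/eqP ?; subst; auto.
Qed.

(** * Wired spanning trees as rooted forests *)

Section WiredTrees.
Context {V : choiceType} (e : rel V).
Hypothesis e_sym : symmetric e.
Hypothesis e_irr : irreflexive e.
Context (U X : {fset V}).
Hypothesis UX : forall v, v \in U -> v \in X.
Hypothesis nbr_X : forall v w, v \in U -> e v w -> w \in X.

Definition interior_set : {set X} := [set v : X | val v \in U].
Definition edge_on : rel X := fun v w => e (val v) (val w).
Local Notation forests := (forests edge_on interior_set).
Implicit Types (f : {ffun X -> X}) (v : X).

Definition out_edge f v (a : edge e) : bool :=
  (v \in interior_set) && (edge_ends a == [fset val v; val (f v)]%fset).

Definition forest_config f : config e := fun a => [exists v, out_edge f v a].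

Lemma edge_ends_inj : injective (@edge_ends V e).
Proof. exact: val_inj. Qed.

Lemma out_edge_ex f v : f \in forests -> v \in interior_set ->
  exists a, out_edge f v a.
Proof.
move=> /forestsP[f_e _ _] vU; have vfv : edge_set e [fset val v; val (f v)]%fset.
  by exists (val v), (val (f v)); split=> //; exact: f_e.
by exists (exist (fun x => x \in edge_set e) _ (mem_set vfv)); rewrite /out_edge vU /edge_ends /=.
Qed.

Lemma wired_ends2 (a : edge e) x y : edge_ends a = [fset x; y]%fset ->
  wired_ends U a = [fset wire U x; wire U y]%fset.
Proof.
move=> axy; apply/fsetP => z; rewrite /wired_ends axy; apply/imfsetP/idP => [[t /= + ->]|].
  by rewrite !inE => /orP[]/eqP ->; rewrite eqxx ?orbT.
by rewrite !inE => /orP[]/eqP ->; [exists x|exists y]; rewrite //= !inE eqxx ?orbT.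
Qed.

Lemma wire_in x : x \in U -> wire U x = Some x.
Proof. by rewrite /wire => ->. Qed.

Lemma out_edge_ends f v a : out_edge f v a ->
  wired_ends U a = [fset Some (val v); wire U (val (f v))]%fset.
Proof.
move=> /andP[]; rewrite inE => vU /eqP /wired_ends2 ->; by rewrite (wire_in vU).
Qed.

Definition parent_edge f (s : option V) : option (edge e) :=
  if pselect (exists a, exists2 v, s = Some (val v) & out_edge f v a) is left h
  then Some (sval (cid h)) else None.

Lemma parent_edgeP f s a :
  parent_edge f s = Some a <-> exists2 v, s = Some (val v) & out_edge f v a.
Proof.
rewrite /parent_edge; case: pselect => [h|h]; last by split=> // sa; case: h; exists a.
have [v sv va] := svalP (cid h); split=> [[<-]|[w sw wa]]; first by exists v.
congr Some; apply: edge_ends_inj.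
have vw : v = w by apply/val_inj; move: sv; rewrite sw => -[].
by move: va wa; rewrite vw => /andP[_ /eqP ->] /andP[_ /eqP ->].
Qed.

Definition rank f v : nat := #|fconnect f v|.

Lemma rank_interior f v : f \in forests -> v \in interior_set ->
  rank f v = (rank f (f v)).+1.
Proof.
move=> fF vU; rewrite /rank (cardD1 v) inE connect0; congr S; apply: eq_card => u.
rewrite !inE; have [->|uv] := eqVneq u v; first exact/esym/negbTE/(forests_acyclic fF).
apply/idP/idP => [/fconnect_step[uv'|//]|fvu]; first by rewrite uv' eqxx in uv.
exact: connect_trans (fconnect1 _ _) fvu.
Qed.

Lemma rank_root f v : f \in forests -> v \notin interior_set -> rank f v = 1.
Proof.
move=> /forestsP[_ f_id _] /f_id fv; rewrite /rank -(card1 v); apply: eq_card => u.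
rewrite !inE; apply/idP/eqP => [/(fconnect_fixed fv)|->] //.
Qed.

(** The value 1 at the wired vertex is the common rank of all the roots identified to it. *)
Definition wired_rank f (s : option V) : nat :=
  if s is Some x then oapp (rank f) 1 (insub x) else 1.

Lemma wired_rank_wire f v : f \in forests -> wired_rank f (wire U (val v)) = rank f v.
Proof.
move=> fF; rewrite /wire; case: ifP => vU; first by rewrite /= valK.
by rewrite (rank_root fF) // inE vU.
Qed.

Lemma forest_joined_root f s : f \in forests -> range (wire U) s ->
  joined (spanning (wired e U) [set a | forest_config f a]) s None.
Proof.
move=> fF [x _ <-]; rewrite /wire; case: ifP => xU; last exact: joined_refl.
have [_ _ f_exit] := forestsP _ _ _ fF.
pose v : X := [` UX xU]%fset; have -> : Some x = wire U (val v) by rewrite /wire /= xU.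
have [u uU /fconnectP[n nu]] := f_exit v.
elim: n (v) nu => [w /= ->|n IH w].
  by rewrite /wire; move: uU; rewrite inE => /negbTE ->; exact: joined_refl.
rewrite iterSr => /IH fw; have [wU|wU] := boolP (w \in interior_set); last first.
  by rewrite /wire; move: wU; rewrite inE => /negbTE ->; exact: joined_refl.
have [a wa] := out_edge_ex fF wU; apply: joined_trans fw.
apply: (joined_edge (a := a)); first by apply/existsP; exists w.
rewrite /= (out_edge_ends wa) [wire U (val w)]wire_in //.
by move: wU; rewrite inE.
Qed.

Lemma forest_connected f : f \in forests ->
  mconnected (spanning (wired e U) [set a | forest_config f a]).
Proof.
move=> fF s t sV tV; apply: joined_trans (forest_joined_root fF sV) _.
exact/joined_sym/forest_joined_root.
Qed.

Lemma forest_spanning_tree f : f \in forests ->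
  spanning_tree (wired e U) [set a | forest_config f a].
Proof.
move=> fF; have [f_e f_id _] := forestsP _ _ _ fF; split.
- move=> a /existsP[v va] /=; rewrite (out_edge_ends va) cardfs2.
  move: va => /andP[vU _]; have evf := f_e _ vU.
  case: eqP => //; rewrite /wire; case: ifP => // _ [vf].
  have E : val v = val (f v) by [].
  by rewrite /edge_on -E e_irr in evf.
- exact: forest_connected.
- apply: (@ranked_acyclic _ _ _ _ (parent_edge f) (wired_rank f)).
  + move=> a s t /existsP[v va]; rewrite /= (out_edge_ends va) => /fset2_eq.
    by case=> -[sv _]; [left|right]; apply/parent_edgeP; exists v.
  + move=> a s t /parent_edgeP[v sv va]; rewrite /= (out_edge_ends va) sv.
    have [vU _] := andP va.
    have rk : wired_rank f (Some (val v)) = rank f v by rewrite /= valK.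
    move=> /fset2_eq[[_ <-]|[<- tv]]; first by rewrite rk wired_rank_wire // rank_interior.
    move: (wired_rank_wire (f v) fF); rewrite tv rk (rank_interior fF vU) => /eqP.
    by rewrite eqn_leq ltnn.
  + move=> a s /parent_edgeP[v sv va]; rewrite /= (out_edge_ends va) sv.
    by rewrite !inE eqxx.
Qed.

(** Where [f] and [g] differ at [w], the edge chosen by [g] at [w] is chosen by [f] at its other end
    [g w], and by acyclicity of [g] they differ there too. The disagreement thus follows the orbit
    under [g] up to a root, where both are the identity. *)
Lemma forest_config_inj : {in forests &, injective forest_config}.
Proof.
move=> f g fF gF fg; apply/ffunP.
have [f_e f_id f_exit] := forestsP _ _ _ fF; have [_ g_id g_exit] := forestsP _ _ _ gF.
move=> v; apply/eqP; apply/contraT => fgv.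
have flip w : f w != g w -> [/\ g w \in interior_set, f (g w) = w & f (g w) != g (g w)].
  move=> fgw; have wU : w \in interior_set.
    by apply: contraT => wU; rewrite f_id ?g_id ?eqxx // in fgw.
  have [a wa] := out_edge_ex gF wU.
  have : forest_config f a by rewrite fg; apply/existsP; exists w.
  case/existsP => u /andP[uU /eqP]; move: wa => /andP[_ /eqP ->] /fset2_eq.
  case=> -[/val_inj wu /val_inj gwu].
    by rewrite gwu wu eqxx in fgw.
  rewrite -gwu in uU wu; split; [exact: uU|exact: esym wu|].
  apply/negP => /eqP fgg; have := forests_acyclic gF uU.
  by rewrite -fgg -wu fconnect1.
suff h n : f (iter n g v) != g (iter n g v).
  have [u uU /fconnectP[n nu]] := g_exit v.
  by move: (h n); rewrite nu f_id // g_id // eqxx.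
by elim: n => [//|n /flip[]].
Qed.

(** Each edge of the walk stays inside [U] and is traversed along [f] or against it; in both cases a
    meeting point for the next vertex yields one for the present vertex. *)
Lemma joined_coalesce f (F : {fset V}) (x y : X) : (F `<=` U)%fset -> f \in forests ->
  x \in interior_set ->
  joined (spanning (graph_of e)
    [set a | forest_config f a /\ (edge_ends a `<=` F)%fset]) (val x) (val y) ->
  coalesce interior_set x f y.
Proof.
move=> FU fF + [p]; elim: p x => [|[a z] p IH] x xU /=.
  by move=> _ /val_inj <-; apply/existsP; exists x; rewrite xU connect0.
move=> [] [/existsP[v /andP[vU /eqP av]] aF] axz zp py.
have zU : z \in U by apply: (fsubsetP (fsubset_trans aF FU)); rewrite axz !inE eqxx orbT.
have /existsP[u /and3P[uU zu yu]] : coalesce interior_set [` UX zU]%fset f y.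
  by apply: IH; rewrite ?inE.
move: axz; rewrite av => /fset2_eq[[/val_inj vx fvz]|[vz /val_inj fvx]].
  apply/existsP; exists u; rewrite uU yu andbT /=.
  apply: connect_trans zu; rewrite -vx.
  have -> : [` UX zU]%fset = f v by exact/val_inj/esym.
  exact: fconnect1.
have zv : [` UX zU]%fset = v by exact/val_inj/esym.
(* Here [x] is the image of [z]. If the meeting point is [z] itself, the orbits meet at [x];
   otherwise it lies on the orbit of [x]. *)
rewrite zv in zu; case: (fconnect_step zu) => [uv|]; last first.
  by rewrite fvx => xu; apply/existsP; exists u; rewrite uU xu.
apply/existsP; exists x; rewrite xU connect0 /=.
by apply: connect_trans yu _; rewrite uv -fvx fconnect1.
Qed.

Hypothesis U_proper : exists x, x \notin U.

(** [delta] is the distance to the wired vertex in the tree, and [w] comes from the first edge of a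
    shortest walk. *)
Lemma tree_walk_to_root (S : set (edge e)) : spanning_tree (wired e U) S ->
  exists delta : option V -> nat, forall v, v \in interior_set ->
    exists w : X, [/\ exists2 a, S a & edge_ends a = [fset val v; val w]%fset
      & delta (wire U (val w)) < delta (Some (val v))].
Proof.
move=> [S_sub S_conn _]; set HS := spanning _ S in S_conn.
pose D s n := exists p, [/\ walk HS s p, last s (unzip2 p) = None & size p = n].
have minD s : exists n, range (wire U) s -> D s n /\ forall k, D s k -> n <= k.
  have [sV|] := pselect (range (wire U) s); last by exists 0.
  have [x0 x0U] := U_proper.
  have [|p sp pN] := S_conn s None sV; first by exists x0; rewrite // /wire (negPf x0U).
  have exD : exists n, `[< D s n >] by exists (size p); apply/asboolP; exists p.
  case: (ex_minnP exD) => n /asboolP nD nmin; exists n => _; split=> // k /asboolP.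
  exact: nmin.
have [delta deltaP] := choice minD; exists delta => v vU.
have vU' : val v \in U by move: vU; rewrite inE.
have sV : range (wire U) (Some (val v)) by exists (val v); rewrite // wire_in.
have [[p [sp pN psize]] _] := deltaP _ sV.
case: p sp pN psize => [//|[a t] p] [Sa avt tp] pN psize.
have /set_mem[x [y [xy aE]]] := valP a; rewrite -/(edge_ends a) in aE.
(* The edge is lifted back to [V]: only [val v] is wired to [Some (val v)], and the other end, being
   a neighbour, lies in [X]. *)
have [w [wX aw wt]] : exists w, [/\ w \in X, edge_ends a = [fset val v; w]%fset & wire U w = t].
  have some_wire z : wire U z = Some (val v) -> z = val v.
    by rewrite /wire; case: ifP => // _ [].
  move: avt; rewrite /= (wired_ends2 aE) => /fset2_eq[[/some_wire xv yt]|[xt /some_wire yv]].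
    exists y; rewrite aE xv yt; split=> //.
    by apply: (nbr_X vU'); rewrite -xv.
  exists x; rewrite aE yv xt fsetUC; split=> //.
  by apply: (nbr_X vU'); rewrite -yv e_sym.
exists [` wX]%fset; split; first by exists a.
rewrite /= wt -psize; have tV : range (wire U) t by exists w.
by have [_ /(_ (size p))] := deltaP _ tV; apply; exists p.
Qed.

(** Orbits exit because [delta] decreases along them. The chosen edges already connect the wired
    graph, so any further edge of [S] would close a cycle. *)
Lemma spanning_tree_forest (S : set (edge e)) : spanning_tree (wired e U) S ->
  exists2 f, f \in forests & S = [set a | forest_config f a].
Proof.
move=> St; have [delta deltaP] := tree_walk_to_root St.
have [S_sub S_conn S_acyc] := St.
have [g gP] : exists g : X -> X, forall v, v \in interior_set ->
    (exists2 a, S a & edge_ends a = [fset val v; val (g v)]%fset) /\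
    delta (wire U (val (g v))) < delta (Some (val v)).
  have h v : exists w : X, v \in interior_set ->
    (exists2 a, S a & edge_ends a = [fset val v; val w]%fset) /\
    delta (wire U (val w)) < delta (Some (val v)).
    have [vU|_] := boolP (v \in interior_set); last by exists v.
    by have [w []] := deltaP v vU; exists w.
  by have [g gP] := choice h; exists g.
pose f := [ffun v => if v \in interior_set then g v else v].
have fF : f \in forests.
  apply/forestsP; split=> v.
  - move=> vU; rewrite ffunE vU /edge_on.
    have [[a _ av] _] := gP v vU; have /set_mem[x [y [xy aE]]] := valP a.
    move: av; rewrite /edge_ends aE => /fset2_eq[[<- <-] //|[<- <-]].
    by rewrite e_sym.
  - by move=> vU; rewrite ffunE (negPf vU).
  - have [n] := ubnP (delta (wire U (val v))); elim: n v => // n IH v.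
    have [vU|vU _] := boolP (v \in interior_set); last by exists v; rewrite // connect0.
    have [_ dlt] := gP v vU; rewrite wire_in; last by move: vU; rewrite inE.
    rewrite ltnS => dn; have [u uU gu] := IH (g v) (leq_trans dlt dn).
    exists u => //; apply: connect_trans gu.
    by have := fconnect1 f v; rewrite {2}/f ffunE vU.
have fS : [set a | forest_config f a] `<=` S.
  move=> a /existsP[v /andP[vU /eqP]]; rewrite ffunE vU.
  have [[b Sb bv] _] := gP v vU; rewrite -bv => /edge_ends_inj ->.
  exact: Sb.
exists f => //; apply/seteqP; split=> // a Sa; apply: contrapT => /negP fa.
have /set_mem[x [y [xy aE]]] := valP a; rewrite -/(edge_ends a) in aE.
have axy := wired_ends2 aE.
have xV : range (wire U) (wire U x) by exists x.
have yV : range (wire U) (wire U y) by exists y.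
have [p [xp py p_uniq]] := simple_walk (forest_connected fF xV yV).
have sx_ty : wire U x <> wire U y.
  by move=> E; have := S_sub _ Sa; rewrite /= axy E cardfs2 eqxx.
apply: (S_acyc (wire U x) (rcons p (a, wire U x))); split.
- by case: (p).
- rewrite -cats1; apply/walk_cat; split.
    by apply: walk_sub xp => // b /set_mem /fS /mem_set.
  by split=> //; rewrite py /= axy fsetUC.
- by rewrite /unzip2 map_rcons last_rcons.
- rewrite /unzip1 map_rcons rcons_uniq (simple_walk_uniq_edges xp p_uniq) andbT.
  by apply/negP => /(walk_edges xp); exact/negP.
- by rewrite /unzip2 map_rcons rcons_uniq.
Qed.

Lemma spanning_trees_forests :
  [set w : config e | spanning_tree (wired e U) [set a | w a]] =
  [set forest_config f | f in [set` forests]].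
Proof.
apply/seteqP; split=> [w /spanning_tree_forest[f fF wf]|_ [f fF <-]].
  exists f => //; apply/funext => a; apply/idP/idP => wa.
    by have : [set a | w a] a by rewrite wf.
  by have : [set a | forest_config f a] a by rewrite -wf.
exact: forest_spanning_tree.
Qed.

End WiredTrees.

Local Open Scope ring_scope.

(** * The Haar measure of the stabilizers *)

(** The filter generated by the cylinders around [f] converges to [f] in each coordinate, hence in
    the product topology. *)
Lemma nbhs_ptws_discrete (I : eqType) (T : topologicalType)
    (T_disc : forall t : T, nbhs t [set t]) (f : {ptws I -> T})
    (B : set {ptws I -> T}) :
  nbhs f B <-> exists D : seq I, [set g : {ptws I -> T} | {in D, g =1 f}] `<=` B.
Proof.
pose F : set_system {ptws I -> T} :=
  [set B | exists D : seq I, [set g : {ptws I -> T} | {in D, g =1 f}] `<=` B].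
have FF : Filter F.
  split.
  - by exists [::].
  - move=> P Q [D DP] [E EQ]; exists (D ++ E) => g gf; split.
      by apply: DP => i iD; apply: gf; rewrite mem_cat iD.
    by apply: EQ => i iE; apply: gf; rewrite mem_cat iE orbT.
  - by move=> P Q PQ [D DP]; exists D => g /DP /PQ.
split.
  suff : F --> f by apply.
  apply/cvg_sup => i A [_ [] [Q oQ <-] Qf QA].
  by exists [:: i] => g gf; apply: QA; rewrite /= gf // mem_head.
case=> D DB; apply: filterS DB _.
elim: D => [|i D IH]; first exact: filterS filterT.
have ni : nbhs f [set g : {ptws I -> T} | g i = f i].
  exact: (@proj_continuous I (fun=> T) i f _ (T_disc (f i))).
apply: filterS (filterI ni IH) => g [gi gD] j.
by rewrite in_cons => /orP[/eqP ->|/gD].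
Qed.

Lemma nbhs_set_type (X : topologicalType) (A : set X) (x : set_type A)
    (B : set (set_type A)) :
  nbhs x B <-> exists2 C, nbhs (val x) C & val @^-1` C `<=` B.
Proof.
split.
  case=> _ [] [Q oQ <-] Qx QB; exists Q => //.
  exact: open_nbhs_nbhs.
case=> C nC CB; apply: filterS CB _.
exact: (@initial_continuous _ _ (val : set_type A -> X) x _ nC).
Qed.

(** * Topology of the group and compactness of vertex stabilizers *)

Section AutTopology.
Context {V : choiceType} (e : rel V).

Lemma nbhs_aut (g : aut e) (B : set (aut e)) :
  nbhs g B <-> exists D : seq V, [set h | {in D, act h =1 act g}] `<=` B.
Proof.
have disc (t : discrete_topology V) : nbhs t [set t] by rewrite nbhs_principalE.
split.
  case/nbhs_set_type => C /(nbhs_ptws_discrete disc)[D DC] CB.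
  by exists D => h hg; apply: CB; apply: DC.
case=> D DB; apply/nbhs_set_type.
exists [set h : {ptws V -> discrete_topology V} | {in D, h =1 val g}].
  by apply/(nbhs_ptws_discrete disc); exists D.
by move=> h /= hg; apply: DB.
Qed.

Context (Gam : subgroup (aut e)).
Implicit Types (g h : sub_aut Gam).

Definition gact g (x : V) : V := act (val g) x.

Lemma nbhs_sub_aut g (B : set (sub_aut Gam)) :
  nbhs g B <-> exists D : seq V, [set h | {in D, gact h =1 gact g}] `<=` B.
Proof.
split.
  case/nbhs_set_type => C /nbhs_aut[D DC] CB.
  by exists D => h hg; apply: CB; apply: DC.
case=> D DB; apply/nbhs_set_type.
exists [set h : aut e | {in D, act h =1 act (val g)}].
  by apply/nbhs_aut; exists D.
by move=> h /= hg; apply: DB.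
Qed.

Lemma gactM g h x : gact (g * h)%g x = gact g (gact h x).
Proof. by []. Qed.

Lemma gact1 x : gact 1%g x = x.
Proof. by []. Qed.

Lemma gactK g : cancel (gact g) (gact g^-1%g).
Proof. by move=> x; rewrite -gactM mulVg gact1. Qed.

Lemma gactVK g : cancel (gact g^-1%g) (gact g).
Proof. by move=> x; rewrite -gactM mulgV gact1. Qed.

Lemma gact_inj g : injective (gact g).
Proof. exact: can_inj (gactK g). Qed.

Lemma gact_e g x y : e (gact g x) (gact g y) = e x y.
Proof. by have [_ ge] := actP (val g); exact: ge. Qed.

Definition stab (D : seq V) : set (sub_aut Gam) :=
  [set g | {in D, gact g =1 id}].

Lemma vstabE x : @vstab V e Gam x = stab [:: x].
Proof.
apply/seteqP; split=> g /=; first by move=> gx y; rewrite inE => /eqP ->.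
by move=> h; apply: h; rewrite mem_head.
Qed.

Definition orb (D : seq V) (y : V) : set V := [set gact g y | g in stab D].

Hypothesis e_lf : locally_finite e.
Hypothesis e_conn : mconnected (graph_of e).

Lemma edge_endsP (a : edge e) x y : edge_ends a = [fset x; y]%fset ->
  e x y \/ e y x.
Proof.
have /set_mem[x' [y' [xy E]]] := valP a.
by rewrite /edge_ends E => /fset2_eq[[<- <-]|[<- <-]]; [left|right].
Qed.

(** Along a path from a fixed vertex of [D], the orbit of each vertex lies in the neighbourhood of
    the finite orbit of the preceding one. *)
Lemma orb_finite D y : D <> [::] -> symmetric e -> finite_set (orb D y).
Proof.
case: D => // x D _ e_sym.
have [p xp <-] := e_conn (I : vset (graph_of e) x) (I : vset (graph_of e) y).
suff step u : walk (graph_of e) u p -> finite_set (orb (x :: D) u) ->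
    finite_set (orb (x :: D) (last u (unzip2 p))).
  apply: step => //.
  apply: (@sub_finite_set _ _ [set x]); last exact: finite_set1.
  by move=> _ [g gD <-]; apply: gD; rewrite mem_head.
elim: p u {xp} => [//|[a z] p IH] u /= [_ uz zp] fu; apply: (IH _ zp).
have euz : e u z by case: (edge_endsP uz) => //; rewrite e_sym.
apply: (@sub_finite_set _ _ (\bigcup_(v in orb (x :: D) u) [set w | e v w])).
  move=> _ [g gD <-]; exists (gact g u); first by exists g.
  by rewrite /= gact_e.
exact: bigcup_finite.
Qed.

Hypothesis e_sym : symmetric e.
Hypothesis Gam_closed : closed (subgroup_set Gam).

Lemma ultra_finite_image (T U : Type) (F : set_system T) (f : T -> U) (A : set U) :
  UltraFilter F -> finite_set A -> F (f @^-1` A) -> exists2 u, A u & F (f @^-1` [set u]).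
Proof.
move=> FU; elim/Pchoice: U => U in f A *.
move=> /finite_seqP[s ->] {A}; elim: s => [|u s IH].
  move=> FA; exfalso; apply: (@filter_not_empty _ F); apply: filterS FA => t /=.
  by rewrite in_nil.
move=> FA; have [Fu|FuC] := in_ultra_setVsetC (f @^-1` [set u]) FU.
  by exists u => //=; rewrite mem_head.
have [|v vs Fv] := IH; last by exists v => //=; rewrite in_cons vs orbT.
apply: filterS (filterI FA FuC) => t [/= + /eqP/negPf].
by rewrite in_cons => /orP[-> //|].
Qed.

(* An ultrafilter on the stabilizer of [x] selects a value in each of the finite
   orbits, and these values form an automorphism. *)
Lemma vstab_compact x : compact (@vstab V e Gam x).
Proof.
rewrite compact_ultra vstabE => F FU Fx.
have sel y : exists u, F [set g | gact g y = u].
  have fin : finite_set (orb [:: x] y) by exact: orb_finite.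
  have [|u _ Fu] := ultra_finite_image (f := fun g : sub_aut Gam => gact g y) FU fin.
    by apply: filterS Fx => g gx; exists g.
  by exists u.
have [p Fp] := choice sel.
have agree (D : seq V) : exists2 g, stab [:: x] g & {in D, gact g =1 p}.
  suff /filter_ex[g [gx gD]] : F (stab [:: x] `&` [set g | {in D, gact g =1 p}]).
    by exists g.
  apply: filterI => //; elim: D => [|y D IH]; first exact: filterS filterT.
  apply: filterS (filterI (Fp y) IH) => g [gy gD] z.
  by rewrite in_cons => /orP[/eqP ->|/gD].
have p_e a b : e (p a) (p b) = e a b.
  have [g _ gp] := agree [:: a; b].
  by rewrite -gp ?inE ?eqxx // -gp ?inE ?eqxx ?orbT // gact_e.
have p_inj : injective p.
  move=> a b; have [g _ gp] := agree [:: a; b].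
  by rewrite -gp ?inE ?eqxx // -gp ?inE ?eqxx ?orbT // => /gact_inj.
have p_surj b : exists a, p a = b.
  have fin : finite_set (orb [:: x] b) by exact: orb_finite.
  (* The preimage of [b] under [g] is not known in advance, but it lies in the finite orbit of [b],
     on all of which [g] agrees with [p]. *)
  have [g gx gp] := agree (fset_set (orb [:: x] b)).
  exists (gact g^-1%g b); rewrite -gp ?gactVK // in_fset_set // inE.
  exists g^-1%g => // z; rewrite inE => /eqP ->.
  by rewrite -{1}(gx x) ?mem_head // gactK.
have p_aut : aut_set e p.
  split=> //; have [q pq] := choice p_surj.
  by exists q => // a; apply: p_inj; rewrite pq.
have p_Gam : subgroup_set Gam (mk_aut p_aut).
  apply: Gam_closed => B /nbhs_aut[D DB].
  have [g _ gp] := agree D; exists (val g); split; last exact: DB.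
  exact: set_mem (valP g).
pose q : sub_aut Gam := exist _ (mk_aut p_aut) (mem_set p_Gam).
exists q; split.
  have [g gx gp] := agree [:: x]; move=> y yx; rewrite -[RHS](gx y yx).
  by rewrite (gp y yx).
move=> B /nbhs_sub_aut[D DB]; apply: filterS DB _.
elim: D => [|y D IH]; first exact: filterS filterT.
apply: filterS (filterI (Fp y) IH) => g [gy gD] z.
by rewrite in_cons => /orP[/eqP ->|/gD].
Qed.

End AutTopology.

Lemma open_borel (T : ptopologicalType) (U : set T) :
  open U -> measurable (U : set (borel T)).
Proof. exact: sub_sigma_algebra. Qed.

(** * Measures of stabilizers and ratios of masses *)

Section Haar.
Context {R : realType} {V : choiceType} {e : rel V}.
Hypothesis e_sym : symmetric e.
Hypothesis e_lf : locally_finite e.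
Hypothesis e_conn : mconnected (graph_of e).
Context {Gam : subgroup (aut e)}.
Hypothesis Gam_closed : closed (subgroup_set Gam).
Hypothesis Gam_trans : transitive_on_vertices Gam.
Context (mu : {measure set (borel (sub_aut Gam)) -> \bar R}).
Hypothesis mu_haar : left_haar mu.
Implicit Types (g h : sub_aut Gam) (D : seq V) (L : seq (V * V)).
Local Notation gact := (@gact V e Gam).
Local Notation stab := (@stab V e Gam).
Local Notation orb := (@orb V e Gam).

Lemma gact_trans x y : exists g, gact g x = y.
Proof.
have [g gG gx] := Gam_trans x y.
by exists (exist _ g (mem_set gG)).
Qed.

(** These sets form a basis of the topology. A nonempty one is a left coset of a pointwise
    stabilizer, so left invariance gives its measure. *)
Definition cyl L : set (sub_aut Gam) :=
  [set g | forall p, p \in L -> gact g p.1 = p.2].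

Lemma cyl_stab L g : cyl L g -> cyl L = [set (g * h)%g | h in stab (unzip1 L)].
Proof.
move=> gL; apply/seteqP; split=> [k kL|_ [h hL <-] p pL]; last first.
  by rewrite gactM hL ?gL // map_f.
exists (g^-1 * k)%g; last by rewrite mulgA mulgV mul1g.
by move=> x /mapP[p pL ->]; rewrite gactM kL // -(gL p pL) gactK.
Qed.

Lemma cyl_measurable L : measurable (cyl L : set (borel (sub_aut Gam))).
Proof.
apply: open_borel; rewrite openE => g gL; apply/nbhs_sub_aut.
exists (unzip1 L) => h hg p pL; rewrite hg ?gL //; exact: map_f.
Qed.

Lemma stab_cyl D : stab D = cyl [seq (x, x) | x <- D].
Proof.
apply/seteqP; split=> g gD.
  by move=> _ /mapP[x xD ->] /=; exact: gD.
by move=> x xD; exact: (gD (x, x)) (map_f _ xD).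
Qed.

Lemma stab_measurable D : measurable (stab D : set (borel (sub_aut Gam))).
Proof. rewrite stab_cyl; exact: cyl_measurable. Qed.

Lemma cyl_mu L g : cyl L g -> mu (cyl L) = mu (stab (unzip1 L)).
Proof.
case: mu_haar => mu_left _ _ _ _ gL.
by rewrite (cyl_stab gL) mu_left //; exact: stab_measurable.
Qed.

Lemma mass_fin_stab D : D <> [::] -> mu (stab D) \is a fin_num.
Proof.
case: mu_haar => _ _ mu_compact _ _; case: D => // x D _.
rewrite ge0_fin_numE //; apply: le_lt_trans (mu_compact (stab [:: x]) _).
  apply: le_measure; rewrite ?inE; [exact: stab_measurable..|].
  by move=> g gD y; rewrite inE => /eqP ->; apply: gD; rewrite mem_head.
by rewrite -vstabE; exact: vstab_compact.
Qed.

(** The stabilizer splits according to the image of [y] into left cosets of [stab (y :: D)], one for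
    each point of the orbit. *)
Lemma stab_orbit D y : D <> [::] ->
  mu (stab D) = (mu (stab (y :: D)) *+ #|` fset_set (orb D y)|)%E.
Proof.
move=> D0; have orb_fin : finite_set (orb D y) by exact: orb_finite.
pose F z := cyl ((y, z) :: [seq (x, x) | x <- D]).
have -> : stab D = \bigcup_(z in orb D y) F z.
  apply/seteqP; split=> [g gD|g [z _ gF]].
    exists (gact g y); first by exists g.
    by move=> p; rewrite in_cons => /orP[/eqP -> //|/mapP[x xD ->]]; exact: gD.
  by move=> x xD; apply: (gF (x, x)); rewrite in_cons map_f ?orbT.
rewrite measure_fin_bigcup //; last 2 first.
- apply/trivIsetP => z z' _ _ zz'; apply/seteqP; split=> // g [gz gz'].
  move/eqP: zz'; apply.
  by move: (gz _ (mem_head _ _)) (gz' _ (mem_head _ _)) => /= <- <-.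
- by move=> z _; exact: cyl_measurable.
rewrite fsbig_finite //= (eq_big_seq (fun=> mu (stab (y :: D)))).
  by rewrite big_const_seq count_predT; rewrite iter_addr_0.
move=> z; rewrite in_fset_set // inE => -[g gD gz].
rewrite (@cyl_mu _ g) /=; first by rewrite /unzip1 -map_comp map_id_in.
by move=> p; rewrite in_cons => /orP[/eqP -> //|/mapP[x xD ->]]; exact: gD.
Qed.

Lemma stab_map g D y :
  orb (map (gact g) D) (gact g y) = [set gact g z | z in orb D y].
Proof.
apply/seteqP; split=> [_ [h hD <-]|_ [_ [h hD <-] <-]].
  exists (gact (g^-1 * h * g)%g y); last by rewrite !gactM gactVK.
  exists (g^-1 * h * g)%g => // x xD.
  by rewrite !gactM hD ?gactK // map_f.
exists (g * h * g^-1)%g; last by rewrite !gactM gactK.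
by move=> _ /mapP[x xD ->]; rewrite !gactM gactK hD.
Qed.

Lemma card_orb_map g D y : D <> [::] ->
  #|` fset_set (orb (map (gact g) D) (gact g y))| = #|` fset_set (orb D y)|.
Proof.
move=> D0; rewrite stab_map fset_set_image; last exact: orb_finite.
by rewrite card_imfset //; exact: gact_inj.
Qed.

Lemma orb_gt0 D y : D <> [::] -> (0 < #|` fset_set (orb D y)|)%N.
Proof.
move=> D0; rewrite cardfs_gt0; apply/fset0Pn; exists y.
rewrite in_fset_set; last exact: orb_finite.
by rewrite inE; exists 1%g.
Qed.

Definition rmass (x : V) : R := fine (mass mu x).

Lemma mass_rmass x : mass mu x = (rmass x)%:E.
Proof. by rewrite /rmass fineK // /mass vstabE; exact: mass_fin_stab. Qed.

Lemma rmassE x : (rmass x)%:E = mu (stab [:: x]).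
Proof. by rewrite -mass_rmass /mass vstabE. Qed.

(** Comparing the stabilizers of [a] and [b] with that of the pair expresses the ratio of the two
    masses by orbit sizes, which do not change when both vertices are moved by [g]. *)
Lemma mass_ratio g x y : rmass x * rmass (gact g y) = rmass y * rmass (gact g x).
Proof.
have key a b : rmass a * #|` fset_set (orb [:: b] a)|%:R
             = rmass b * #|` fset_set (orb [:: a] b)|%:R.
  apply: EFin_inj; rewrite !EFinM !mule_natr !rmassE.
  rewrite (stab_orbit (D := [:: a]) b) // (stab_orbit (D := [:: b]) a) //.
  rewrite (_ : stab [:: a; b] = stab [:: b; a]); last first.
    by apply/seteqP; split=> h hD z zD; apply: hD; move: zD; rewrite !inE orbC.
  by rewrite -!mule_natr -!muleA [X in (_ * X)%E]muleC.
have kxy := key x y; have kg := key (gact g x) (gact g y).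
rewrite (card_orb_map g (D := [:: y])) // (card_orb_map g (D := [:: x])) // in kg.
set n := _%:R in kxy kg; set n' := _%:R in kxy kg.
have n0 : n != 0 by rewrite pnatr_eq0 -lt0n orb_gt0.
have n'0 : n' != 0 by rewrite pnatr_eq0 -lt0n orb_gt0.
apply: (mulIf n0); apply: (mulIf n'0).
by rewrite -mulrA mulrACA kxy -kg -[RHS]mulrA [n * n']mulrC [RHS]mulrACA.
Qed.

Lemma vertex_stab_mu x y g : gact g x = y ->
  mu [set h | gact h x = y] = (rmass x)%:E.
Proof.
move=> gx; rewrite rmassE -[RHS](@cyl_mu [:: (x, y)] g); last first.
  by move=> p; rewrite inE => /eqP ->.
congr (mu _); apply/seteqP; split=> h hx; first by move=> p; rewrite inE => /eqP ->.
by apply: (hx (x, y)); rewrite mem_head.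
Qed.

Lemma vertex_measurable y z :
  measurable ([set g | gact g y = z] : set (borel (sub_aut Gam))).
Proof.
rewrite (_ : [set g | _] = cyl [:: (y, z)]); first exact: cyl_measurable.
apply/seteqP; split=> h hx; first by move=> p; rewrite inE => /eqP ->.
by apply: (hx (y, z)); rewrite mem_head.
Qed.

Definition nbrs (x : V) : {fset V} := fset_set [set y | e x y].

Lemma in_nbrs x y : (y \in nbrs x) = e x y.
Proof.
rewrite in_fset_set; last exact: e_lf.
by apply/idP/idP => [/set_mem|] // xy; exact: mem_set.
Qed.

Lemma mu_bigcup_nbrs x (F : V -> set (sub_aut Gam)) :
  (forall y, measurable (F y : set (borel (sub_aut Gam)))) ->
  (forall y z, F y `&` F z !=set0 -> y = z) ->
  mu (\bigcup_(y in [set y | e x y]) F y) = (\sum_(y <- nbrs x) mu (F y))%E.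
Proof.
move=> Fm Fd; rewrite measure_fin_bigcup; [|exact: e_lf| |by move=> *; exact: Fm].
  by rewrite fsbig_finite //; exact: e_lf.
by apply/trivIsetP => y z _ _ yz; apply/eqP; apply: contraNT yz => /set0P/Fd ->.
Qed.

(* The set of the [g] moving [x] to a neighbour is invariant under inversion:
   it is a union of left cosets of the stabilizer of [x], and of left cosets of
   the stabilizers of the neighbours. *)
Lemma sum_mass_nbrs x : \sum_(y <- nbrs x) rmass y = #|` nbrs x|%:R * rmass x.
Proof.
pose S : set (sub_aut Gam) := [set g | e x (gact g x)].
have S1 : S = \bigcup_(y in [set y | e x y]) [set g | gact g x = y].
  by apply/seteqP; split=> [g xg|g [y xy] /= gx]; [exists (gact g x)|rewrite /S /= gx].
have S2 : S = \bigcup_(y in [set y | e x y]) [set g | gact g y = x].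
  apply/seteqP; split=> [g xg|g [y xy] /= gy].
    exists (gact g^-1%g x); rewrite /= ?gactVK //.
    by rewrite -(gact_e g) gactVK e_sym.
  by rewrite /S /= -{1}gy gact_e e_sym.
apply: EFin_inj; transitivity (mu S).
  rewrite S2 mu_bigcup_nbrs; [|by move=> y; exact: vertex_measurable|]; last first.
    by move=> y z [g [/= gy gz]]; apply: (@gact_inj _ _ _ g); rewrite gy.
  rewrite -sumEFin; apply: eq_bigr => y _.
  by have [g gy] := gact_trans y x; rewrite (vertex_stab_mu gy).
rewrite S1 mu_bigcup_nbrs; [|by move=> y; exact: vertex_measurable|by move=> y z [g [/= <- <-]]].
rewrite (eq_bigr (fun=> (rmass x)%:E)); last first.
  by move=> y _; have [g gx] := gact_trans x y; rewrite (vertex_stab_mu gx).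
by rewrite sumEFin big_const_seq count_predT iter_addr_0 mulr_natl.
Qed.

Context (enum : nat -> V) (enum_surj : forall x, exists n, enum n = x).

(** Countably many left cosets of the stabilizer cover the group, which would otherwise be null. *)
Lemma mass_gt0 x : 0 < rmass x.
Proof.
case: mu_haar => _ mu_neq0 _ _ _.
rewrite lt_neqAle fine_ge0 // andbT; apply/eqP => mx0; apply: mu_neq0.
have -> : [set: sub_aut Gam] = \bigcup_n [set h | gact h x = enum n].
  apply/seteqP; split=> // g _; have [n gn] := enum_surj (gact g x).
  by exists n.
apply/eqP; rewrite eq_le measure_ge0 andbT.
have meas n : measurable ([set h | gact h x = enum n] : set (borel (sub_aut Gam))).
  exact: vertex_measurable.
apply: le_trans (generalized_Boole_inequality mu meas _) _.
  exact: bigcupT_measurable.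
rewrite eseries0 // => n _ _; have [g gx] := gact_trans x (enum n).
by rewrite (vertex_stab_mu gx) -mx0.
Qed.

(** * Constant mass and right invariance *)

Definition rmul (g h : sub_aut Gam) : sub_aut Gam := (h * g)%g.

Lemma rmul_continuous g : continuous (rmul g).
Proof.
move=> h B /nbhs_sub_aut[D DB]; apply/nbhs_sub_aut.
exists (map (gact g) D) => k kh; apply: DB => x xD.
by rewrite /rmul !gactM kh // map_f.
Qed.

Lemma rmul_measurable g :
  measurable_fun [set: borel (sub_aut Gam)] (rmul g : borel _ -> borel (sub_aut Gam)).
Proof.
apply: (@measurability _ _ (borel (sub_aut Gam)) (borel (sub_aut Gam)) setT (rmul g)
  (@open (sub_aut Gam)) erefl) => _ [B oB <-].
rewrite setTI; apply: open_borel; apply: open_comp => // h _.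
exact: rmul_continuous.
Qed.

Lemma rmul_image g (A : set (sub_aut Gam)) :
  [set (h * g)%g | h in A] = rmul g^-1%g @^-1` A.
Proof.
apply/seteqP; split=> [_ [h hA <-]|h hA]; first by rewrite /rmul /= mulgK.
by exists (h * g^-1)%g => //; rewrite mulgVK.
Qed.

Lemma cyl_rmul L g :
  rmul g @^-1` (cyl L) = cyl [seq (gact g p.1, p.2) | p <- L].
Proof.
apply/seteqP; split=> h hL; first by move=> _ /mapP[p pL ->] /=; exact: hL.
by move=> p pL; exact: (hL _ (map_f _ pL)).
Qed.

(** Induction on [D]: by [stab_orbit], adding a vertex divides both sides by the same orbit size. *)
Lemma stab_map_mu (m_const : forall x y, rmass x = rmass y) g D :
  mu (stab (map (gact g) D)) = mu (stab D).
Proof.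
elim: D => [//|y D IH]; have [->|D0] := eqVneq D [::].
  by rewrite /= -!rmassE; congr EFin; exact: m_const.
have D0' : D <> [::] by exact/eqP.
have gD0 : map (gact g) D <> [::] by case: (D) D0'.
move: IH; rewrite (stab_orbit (gact g y) gD0) (stab_orbit y D0') card_orb_map //=.
have /fineK <- := @mass_fin_stab (y :: D) ltac:(done).
have /fineK <- := @mass_fin_stab (gact g y :: map (gact g) D) ltac:(done).
rewrite -!EFin_natmul => -[] /eqP.
by rewrite eqrMn2r (gtn_eqF (orb_gt0 y D0')) /= => /eqP ->.
Qed.

(** There are countably many vertices, hence countably many cylinders, and every open set is a
    countable union of cylinders. *)
Lemma borel_cyl :
  @measurable _ (borel (sub_aut Gam)) = <<s range cyl >>.
Proof.
apply/seteqP; split; last first.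
  apply: smallest_sub; first exact: sigma_algebra_measurable.
  by move=> _ [L _ <-]; exact: cyl_measurable.
apply: smallest_sub; first exact: smallest_sigma_algebra.
move=> U oU; pose code (l : seq (nat * nat)) := [seq (enum p.1, enum p.2) | p <- l].
pose F l := if `[< cyl (code l) `<=` U >] then cyl (code l) else set0.
have -> : U = \bigcup_l F l.
  apply/seteqP; split=> [g gU|g [l _]]; last first.
    by rewrite /F; case: asboolP => // lU /lU.
  have /nbhs_sub_aut[D DU] : nbhs g U by exact: open_nbhs_nbhs.
  have [idx idxK] := choice enum_surj.
  exists [seq (idx x, idx (gact g x)) | x <- D] => //.
  have E : code [seq (idx x, idx (gact g x)) | x <- D] = [seq (x, gact g x) | x <- D].
    by rewrite /code -map_comp; apply: eq_map => x /=; rewrite !idxK.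
  rewrite /F E; case: asboolP => [_|]; first by move=> _ /mapP[x _ ->].
  case=> h hD; apply: DU => x xD; exact: (hD _ (map_f _ xD)).
apply: (@countable_bigcupT_measurable _ (g_sigma_algebraType (range cyl))).
  exact: countableP.
move=> l; rewrite /F; case: asboolP => _; last exact: measurable0.
by apply: sub_sigma_algebra; exists (code l).
Qed.

(** The cylinders are stable under intersection and generate the Borel sets, and right translation
    preserves their measure; uniqueness of measures applies, the group being a countable union of
    cylinders of finite measure. *)
Lemma constant_mass_right_invariant :
  (forall x y, rmass x = rmass y) -> right_invariant mu.
Proof.
move=> m_const g A mA; rewrite rmul_image.
pose nu : {measure set (borel (sub_aut Gam)) -> \bar R} :=
  measure_function_pushforward__canonical__measure_function_Measure mu (rmul_measurable g^-1%g).
rewrite -[LHS]/(nu A).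
symmetry; apply: (@measure_unique _ _ (borel (sub_aut Gam)) (range cyl)
  (fun n => cyl [:: (enum 0%N, enum n)]) _ _ _ _ mu nu) => //.
- exact: borel_cyl.
- move=> _ _ [L _ <-] [L' _ <-]; exists (L ++ L') => //.
  apply/seteqP; split=> [h hL|h [hL hL'] p].
    by split=> p pL; apply: hL; rewrite mem_cat pL ?orbT.
  by rewrite mem_cat => /orP[/hL|/hL'].
- apply/seteqP; split=> // h _; have [n hn] := enum_surj (gact h (enum 0%N)).
  by exists n => // p; rewrite inE => /eqP ->.
- move=> _ [L _ <-]; rewrite /nu /= /pushforward cyl_rmul.
  have [[h hL]|/set0P/negP/negPn/eqP L0] := pselect (cyl L !=set0).
    rewrite (cyl_mu hL) (@cyl_mu _ (h * g)%g); last first.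
      move=> _ /mapP[p pL ->] /=; rewrite gactM gactVK; exact: hL.
    rewrite -[LHS](stab_map_mu m_const g^-1%g (unzip1 L)); congr (mu (stab _)).
    by rewrite /unzip1 -!map_comp.
  by rewrite -cyl_rmul L0 preimage_set0.
- move=> n; have [g0 gn] := gact_trans (enum 0%N) (enum n).
  rewrite (@cyl_mu _ g0) -?rmassE ?ltry //.
  by move=> p; rewrite inE => /eqP ->.
Qed.

(** * Excessivity of the square root of the mass *)

Lemma nbrs_gact g x : nbrs (gact g x) = [fset gact g y | y in nbrs x]%fset.
Proof.
apply/fsetP => z; rewrite in_nbrs; apply/idP/imfsetP => [xz|[y /= + ->]].
  exists (gact g^-1%g z); rewrite ?gactVK //= in_nbrs.
  by rewrite -(gact_e g) gactVK.
by rewrite in_nbrs gact_e.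
Qed.

Lemma card_nbrs x y : #|` nbrs x| = #|` nbrs y|.
Proof.
have [g <-] := gact_trans y x.
by rewrite nbrs_gact card_imfset //; exact: gact_inj.
Qed.

Lemma sum_nbrs_gact (s : V -> R) g x :
  \sum_(w <- nbrs (gact g x)) s w = \sum_(w <- nbrs x) s (gact g w).
Proof. by rewrite nbrs_gact big_imfset //= => ? ? _ _; exact: gact_inj. Qed.

Definition root_mass (x : V) : R := Num.sqrt (rmass x).

Lemma root_mass_gt0 x : 0 < root_mass x.
Proof. by rewrite sqrtr_gt0 mass_gt0. Qed.

Lemma root_mass_sq x : root_mass x ^+ 2 = rmass x.
Proof. by rewrite sqr_sqrtr // fine_ge0 // measure_ge0. Qed.

Lemma root_mass_ratio g x y :
  root_mass x * root_mass (gact g y) = root_mass y * root_mass (gact g x).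
Proof. by rewrite -!sqrtrM ?ltW ?mass_gt0 // mass_ratio. Qed.

(** Expand the squares and use harmonicity of the mass. The subtracted sum measures the strict
    concavity of the square root. *)
Lemma sum_root_mass_nbrs x :
  \sum_(w <- nbrs x) root_mass w * root_mass x =
  #|` nbrs x|%:R * rmass x - 2^-1 * \sum_(w <- nbrs x) (root_mass w - root_mass x) ^+ 2.
Proof.
under [X in _ - _ * X]eq_bigr => w _ do rewrite sqrrB !root_mass_sq.
rewrite big_split sumrB /= sum_mass_nbrs big_const_seq count_predT iter_addr_0.
rewrite sumrMnl -(mulr_natl (rmass x)).
set A := _ * rmass x; set B := \sum_(i <- _) _.
rewrite addrAC -mulr2n mulrBr -(mulr_natl A) -(mulr_natl B) !mulrA mulVf ?pnatr_eq0 //.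
by rewrite !mul1r subKr.
Qed.

(** [mass_ratio] carries the equality from [x] to the neighbours of every vertex, and the graph is
    connected. *)
Lemma constant_mass x :
  (forall w, w \in nbrs x -> rmass w = rmass x) -> forall y z, rmass y = rmass z.
Proof.
move=> mx.
have step y z : e y z -> rmass y = rmass z.
  have [g <-] := gact_trans x y => yz.
  have /mx : gact g^-1%g z \in nbrs x by rewrite in_nbrs -(gact_e g) gactVK.
  move=> E; have := mass_ratio g x (gact g^-1%g z); rewrite gactVK E => /mulfI h.
  by apply/esym/h; rewrite gt_eqF ?mass_gt0.
move=> y z; have [p] := e_conn (I : vset (graph_of e) y) (I : vset (graph_of e) z).
elim: p y => [y _ <- //|[a u] p IH] y /= [_ yu up] pz; rewrite -(IH _ up pz).
by case: (edge_endsP yu) => /step.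
Qed.

Lemma excessive_root_mass : ~ unimodular R Gam ->
  exists d (psi : R), [/\ forall x, #|` nbrs x| = d, psi < d%:R
    & forall x, \sum_(w <- nbrs x) root_mass w <= psi * root_mass x].
Proof.
move=> nonuni; pose o := enum 0%N.
(* The ratio at [o] is the ratio at every vertex, by [root_mass_ratio]. Were it not below the
   degree, all squares in [sum_root_mass_nbrs] would vanish and the mass would be constant. *)
exists #|` nbrs o|, ((\sum_(w <- nbrs o) root_mass w) / root_mass o).
have so := root_mass_gt0 o.
split=> [x||x]; first exact: card_nbrs.
  rewrite ltr_pdivrMr // -(ltr_pM2r so) -[ltRHS]mulrA -expr2 root_mass_sq mulr_suml.
  rewrite sum_root_mass_nbrs ltrBlDr ltrDl mulr_gt0 ?invr_gt0 //.
  rewrite lt_neqAle eq_sym sumr_ge0 ?andbT => [|w _]; last exact: sqr_ge0.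
  apply/negP; rewrite psumr_eq0 => [|w _]; last exact: sqr_ge0.
  move=> /allP h; apply: nonuni; exists mu; split=> //.
  apply: constant_mass_right_invariant; apply: (@constant_mass o) => w /h /=.
  rewrite sqrf_eq0 subr_eq0 => /eqP wo.
  by rewrite -!root_mass_sq wo.
have [g <-] := gact_trans o x.
rewrite sum_nbrs_gact mulrAC ler_pdivlMr // mulr_suml mulr_suml.
apply: ler_sum => w _.
by rewrite mulrC root_mass_ratio.
Qed.

End Haar.

(** * Clusters of the wired uniform spanning forest *)

Lemma continuous_borel_measurable (R : realType) (T : ptopologicalType) (f : T -> R) :
  continuous f -> measurable_fun [set: borel T] (f : borel T -> R).
Proof.
move=> fc; apply: (measurability _ (measurable_realfun.RGenOInfty.measurableE R)) => _ [_ [x ->] <-].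
rewrite setTI; apply: open_borel; apply: open_comp; last exact: interval_open.
by move=> ? _; exact: fc.
Qed.

Lemma integral_uniform_measure (R : realType) (T : ptopologicalType) (S : set T)
    (f : T -> R) : continuous f -> (forall x, 0 <= f x) ->
  (\int[uniform_measure R S]_x (f x)%:E =
   ((#|` fset_set S|%:R)^-1 * \sum_(x <- fset_set S) f x)%:E)%E.
Proof.
move=> fc f0.
have fm : measurable_fun [set: borel T] (EFin \o f : borel T -> \bar R).
  by apply/measurable_EFinP; exact: continuous_borel_measurable.
rewrite /uniform_measure ge0_integral_mscale //; last by move=> x _; rewrite lee_fin.
rewrite ge0_integral_measure_sum //; last by move=> x _; rewrite lee_fin.
rewrite EFinM -sumEFin; congr (_ * _)%E.
rewrite (big_nth point) big_mkord; apply: eq_bigr => i _.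
by rewrite integral_dirac // diracT mul1e.
Qed.

Lemma big_subtype_fset (R : Type) (idx : R) (op : Monoid.com_law idx) (V : choiceType)
    (A X : {fset V}) (F : V -> R) : {subset A <= X} ->
  \big[op/idx]_(x : X | val x \in A) F (val x) = \big[op/idx]_(x <- A) F x.
Proof.
move=> AX; rewrite -(big_seq_fsetE _ _ (mem A)) -big_filter; apply: perm_big.
apply: uniq_perm; rewrite ?filter_uniq ?fset_uniq // => x.
by rewrite mem_filter /=; have [xA|] := boolP (x \in A); rewrite //= AX.
Qed.

(** * Weight of a cluster inside a finite set *)

Section Clusters.
Context {R : realType} {V : choiceType} (e : rel V).
Implicit Types (F U : {fset V}) (w : config e) (x y : V).

(** Only edges inside [F] are allowed, so this depends on finitely many edges and yields continuous
    functions of [w]. *)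
Definition cluster_in F w x y : Prop :=
  joined (spanning (graph_of e) [set a | w a /\ (edge_ends a `<=` F)%fset]) x y.

Lemma cluster_in_mono F F' w x y : (F `<=` F')%fset ->
  cluster_in F w x y -> cluster_in F' w x y.
Proof.
move=> FF' [p xp py]; exists p => //; apply: walk_sub xp => //.
move=> a /set_mem[wa aF]; apply/mem_set; split=> //.
exact: fsubset_trans FF'.
Qed.

Context (s : V -> R).
Hypothesis s_gt0 : forall x, 0 < s x.

Definition cluster_weight F x w : R := \sum_(y <- F | `[< cluster_in F w x y >]) s y.

Lemma cluster_weight_ge0 F x w : 0 <= cluster_weight F x w.
Proof. by apply: sumr_ge0 => y _; exact: ltW. Qed.

Lemma fset_sum_le (A B : {fset V}) (P Q : pred V) :
  (forall x, x \in A -> P x -> (x \in B) && Q x) ->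
  \sum_(x <- A | P x) s x <= \sum_(x <- B | Q x) s x.
Proof.
move=> AB; rewrite [leRHS](bigID (mem [fset x in A | P x]%fset)) /=.
rewrite -[leLHS]addr0 lerD //; last by apply: sumr_ge0 => x _; exact: ltW.
rewrite -[leLHS]big_filter -[leRHS]big_filter le_eqVlt; apply/orP; left; apply/eqP.
apply: perm_big; apply: uniq_perm; rewrite ?filter_uniq ?fset_uniq // => x.
rewrite !mem_filter !inE /= andbC; have [xA|_] := boolP (x \in A); last by rewrite andbF.
by case Px: (P x); rewrite ?andbF //=; have /andP[-> ->] := AB x xA Px.
Qed.

Lemma cluster_weight_mono F F' x w : (F `<=` F')%fset ->
  cluster_weight F x w <= cluster_weight F' x w.
Proof.
move=> FF'; apply: fset_sum_le => y yF /asboolP xy; rewrite (fsubsetP FF') //=.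
exact/asboolP/(cluster_in_mono FF').
Qed.

Lemma cluster_weight_local F x w w' :
  (forall a, (edge_ends a `<=` F)%fset -> w a = w' a) ->
  cluster_weight F x w = cluster_weight F x w'.
Proof.
move=> ww'; rewrite /cluster_weight; apply: eq_bigl => y; congr asbool.
rewrite /cluster_in; congr (joined (spanning _ _) x y).
by apply/seteqP; split=> a /= [wa aF]; split=> //; move: wa; rewrite ww'.
Qed.

Lemma cluster_weight_continuous F x : continuous (cluster_weight F x : config e -> R).
Proof.
move=> w B nB.
have disc (b : bool) : nbhs b [set b] by rewrite nbhs_principalE.
apply/(nbhs_ptws_discrete disc).
(* These are the subsets of [F] that are edges. *)
exists (pmap (insub : {fset V} -> option (set_type (edge_set e))) (fpowerset F)).
move=> w' w'w /=; rewrite (@cluster_weight_local F x w' w); first exact: nbhs_singleton nB.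
by move=> a aF; apply: w'w; rewrite mem_pmap_sub fpowersetE.
Qed.

Lemma cluster_weight_le F x w : `|cluster_weight F x w| <= \sum_(y <- F) s y.
Proof.
rewrite ger0_norm ?cluster_weight_ge0 //.
by apply: fset_sum_le => y yF _; rewrite yF.
Qed.

Hypothesis e_sym : symmetric e.
Hypothesis e_irr : irreflexive e.
Hypothesis e_lf : locally_finite e.
Context (d : nat) (psi : R).
Local Notation nbrs := (@nbrs V e).
Hypothesis card_nbrs : forall x, #|` nbrs x| = d.
Hypothesis psi_d : psi < d%:R.
Hypothesis s_exc : forall x, \sum_(w <- nbrs x) s w <= psi * s x.

(** The integral is an average over rooted forests, and vertices joined to [x] inside [F] coalesce
    with it, so [sum_coalesce] applies. *)
Lemma ust_cluster_weight F U x : (F `<=` U)%fset -> x \in U ->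
  (exists y, y \notin U) ->
  (\int[ust R (wired e U)]_w (cluster_weight F x w)%:E <=
   (d%:R ^+ 2 * s x / (d%:R - psi) ^+ 2)%:E)%E.
Proof.
move=> FU xU U_proper.
(* The neighbours outside [U] serve as separate roots, which keeps parallel edges to the wired
   vertex distinct. *)
pose X := (U `|` \bigcup_(v <- U) nbrs v)%fset.
have UX v : v \in U -> v \in X by move=> vU; rewrite !inE vU.
have nbr_X v z : v \in U -> e v z -> z \in X.
  move=> vU vw; rewrite !inE; apply/orP; right; apply/bigfcupP; exists v; rewrite ?vU //.
  by rewrite in_nbrs.
pose inner : {set X} := interior_set U X.
pose trees := forests (@edge_on V e X) inner.
have ix (y : X) : y \in inner = (val y \in U) by rewrite inE.
have nbrX (v : X) : v \in inner -> {subset nbrs (val v) <= X}.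
  by rewrite ix => vU y; rewrite in_nbrs //; exact: nbr_X.
have eX (v w : X) : @edge_on V e X v w = (val w \in nbrs (val v)) by rewrite in_nbrs.
have deg v : v \in inner -> #|[pred w | @edge_on V e X v w]| = d.
  move=> /nbrX vX; rewrite -(card_nbrs (val v)) -sum1_card (eq_bigl _ _ (eX v)).
  by rewrite (big_subtype_fset _ (fun=> 1%N)) // big_const_seq count_predT iter_addn_0 mul1n.
have exc v : v \in inner ->
    \sum_(w | @edge_on V e X v w) s (val w) <= psi * s (val v).
  move=> /nbrX vX; rewrite (eq_bigl _ _ (eX v)) (big_subtype_fset _ s) //.
have xI : [` UX x xU]%fset \in inner by rewrite ix.
have sym : symmetric (@edge_on V e X) by move=> u v; rewrite /edge_on e_sym.
have := sum_coalesce sym (fun v : X => ltW (s_gt0 (val v)))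
  (fun v _ => s_gt0 (val v)) deg exc psi_d xI.
rewrite -/trees => bound.
rewrite /ust (spanning_trees_forests e_sym e_irr UX nbr_X U_proper).
rewrite integral_uniform_measure; [|exact: cluster_weight_continuous|exact: cluster_weight_ge0].
have perm : perm_eq (fset_set [set @forest_config V e U X f | f in [set` trees]])
    [seq @forest_config V e U X f | f <- enum trees].
  apply: uniq_perm; first exact: fset_uniq.
    rewrite map_inj_in_uniq ?enum_uniq // => f g; rewrite !mem_enum.
    exact: forest_config_inj.
  move=> w; rewrite in_fset_set; last exact/finite_image/finite_finset.
  apply/idP/mapP => [/set_mem[f fT <-]|[f fT ->]]; first by exists f; rewrite ?mem_enum.
  by apply/mem_set; exists f => //=; rewrite mem_enum in fT.
rewrite (perm_big _ perm) /= (perm_size perm) size_map -cardE big_map big_enum /= lee_fin.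
have d_gt0 : 0 < d%:R - psi by rewrite subr_gt0.
(* With no tree the average is 0, as the inverse of 0 is 0. *)
have [->|trees0] := eqVneq #|trees| 0%N.
  by rewrite invr0 mul0r divr_ge0 ?mulr_ge0 ?sqr_ge0 ?(ltW (s_gt0 _)) ?(ltW d_gt0).
have trees_gt0 : 0 < #|trees|%:R :> R by rewrite ltr0n lt0n.
rewrite mulrC ler_pdivrMr // mulrAC ler_pdivlMr ?exprn_gt0 // mulrC.
apply: le_trans bound; rewrite ler_wpM2l ?exprn_ge0 ?(ltW d_gt0) //.
apply: ler_sum => f fT.
have FX : {subset F <= X} by move=> y /(fsubsetP FU)/UX.
apply: (@le_trans _ _ (\sum_(y <- X | (y \in F) && `[< cluster_in F (@forest_config V e U X f) x y >]) s y)).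
  by apply: fset_sum_le => y yF ->; rewrite yF FX.
rewrite big_seq_fsetE /= big_mkcond [leRHS]big_mkcond; apply: ler_sum => y _.
case: ifP => [/andP[yF /asboolP xy]|_]; last first.
  by case: ifP => // _; exact: ltW.
rewrite ix (fsubsetP FU) //= (joined_coalesce UX FU fT xI) //.
Qed.

End Clusters.

(** * Exhaustions by finite sets *)

Section Exhaustion.
Context {V : choiceType} {e : rel V} (V_ : nat -> {fset V}).
Hypothesis exhV : exhaustion e V_.

Lemma exhaustion_mono : {homo V_ : m n / (m <= n)%N >-> (m `<=` n)%fset}.
Proof.
have [V_S _ _] := exhV.
apply: homo_leq => [A|B A C|//]; [exact: fsubset_refl|exact: fsubset_trans].
Qed.

Lemma exhaustion_near (A : {fset V}) : \forall n \near \oo, (A `<=` V_ n)%fset.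
Proof.
have [_ V_cover _] := exhV.
elim/finSet_rect: A => A IH; have [->|/fset0Pn[x xA]] := eqVneq A fset0.
  by apply: nearW => n; exact: fsub0set.
have [n xn] := V_cover x.
have near_n : \forall k \near \oo, (n <= k)%N by exact: nbhs_infty_ge.
have near_A : \forall k \near \oo, (A `\ x `<=` V_ k)%fset.
  by apply: IH; exact: fproperD1.
near=> k; rewrite -(fsetD1K xA) fsubUset fsub1set.
apply/andP; split; last by near: k.
by apply: (fsubsetP (exhaustion_mono _)) xn; near: k.
Unshelve. all: by end_near. Qed.

Lemma exhaustion_enum : infinite_set [set: V] ->
  exists enum : nat -> V, forall x, exists n, enum n = x.
Proof.
move=> V_inf.
have V_countable : countable [set: V].
  have -> : [set: V] = \bigcup_n [set` V_ n].
    apply/seteqP; split=> // x _; have [_ V_cover _] := exhV.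
    by have [n xn] := V_cover x; exists n.
  by apply: bigcup_countable => // n _; exact/finite_set_countable/finite_fset.
have /set0P[x0 _] : [set: V] != set0.
  by apply/eqP => V0; apply: V_inf; rewrite V0; exact: finite_set0.
have /countable_injP[f f_inj] := V_countable.
exists (fun n => xget x0 [set x | f x = n]) => x; exists (f x).
case: xgetP => [y -> yx|/(_ x) /(_ erefl) //].
by apply: f_inj; rewrite ?in_setT.
Qed.

End Exhaustion.

(** * Passage to the limit *)

Section WiredForest.
Context {R : realType} {V : choiceType} {e : rel V}.
Hypothesis e_sym : symmetric e.
Hypothesis e_irr : irreflexive e.
Hypothesis e_lf : locally_finite e.
Hypothesis V_inf : infinite_set [set: V].
Context {V_ : nat -> {fset V}} (exhV : exhaustion e V_).
Context {P : probability (borel (config e)) R}.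
Hypothesis P_lim : weak_cvg (fun n => ust R (wired e (V_ n))) P.
Context {s : V -> R} (s_gt0 : forall x, 0 < s x).
Context {d : nat} {psi : R}.
Hypothesis card_nbrs : forall x, #|` @nbrs V e x| = d.
Hypothesis psi_d : psi < d%:R.
Hypothesis s_exc : forall x, \sum_(w <- @nbrs V e x) s w <= psi * s x.

(** For fixed [F] the weight is bounded and continuous, so weak convergence preserves a bound that
    does not depend on [n]. *)
Lemma wusf_cluster_weight F x :
  (\int[P]_w (cluster_weight s F x (w : config e))%:E <=
   (d%:R ^+ 2 * s x / (d%:R - psi) ^+ 2)%:E)%E.
Proof.
have bounded : exists M, forall w : config e, `|cluster_weight s F x w| <= M.
  by exists (\sum_(y <- F) s y) => w; exact: cluster_weight_le.
have lim := P_lim (@cluster_weight_continuous R V e s F x) bounded.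
apply: (cvge_to_le lim).
near=> n; apply: ust_cluster_weight => //.
- by near: n; exact: (exhaustion_near exhV).
- rewrite -fsub1set; near: n; exact: (exhaustion_near exhV).
- apply: contrapT => VU; apply: V_inf; rewrite (_ : [set: V] = [set` V_ n]).
    exact: finite_fset.
  by apply/seteqP; split=> // y _; apply: contrapT => /negP yV; apply: VU; exists y.
Unshelve. all: by end_near. Qed.

(** The weights increase with [k] and their integrals are uniformly bounded; by monotone convergence
    the limit is integrable, hence almost surely finite. *)
Lemma wusf_cluster_weight_bounded x :
  {ae P, forall w : config e, exists M, forall k, cluster_weight s (V_ k) x w <= M}.
Proof.
pose g k (w : borel (config e)) := (cluster_weight s (V_ k) x w)%:E.
have gm k : measurable_fun [set: borel (config e)] (g k).
  apply/measurable_EFinP; apply: continuous_borel_measurable.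
  exact: cluster_weight_continuous.
have g0 k w : (0 <= g k w)%E by rewrite lee_fin; exact: cluster_weight_ge0.
have g_mono w : {homo g^~ w : k l / (k <= l)%N >-> (k <= l)%E}.
  move=> k l kl; rewrite lee_fin; apply: cluster_weight_mono => //.
  exact: (exhaustion_mono exhV).
have lim_fin : (\int[P]_w limn (g^~ w) < +oo)%E.
  apply: le_lt_trans (ltry (d%:R ^+ 2 * s x / (d%:R - psi) ^+ 2)).
  have lim := cvg_monotone_convergence (mu := P) measurableT gm (fun k w _ => g0 k w)
    (fun w _ => g_mono w).
  apply: (cvge_to_le lim).
  by apply: nearW => k; exact: wusf_cluster_weight.
have g_cvg w : cvgn (g^~ w) by exact/ereal_nondecreasing_is_cvgn/g_mono.
have lim_ge0 w : (0 <= limn (g^~ w))%E by apply: lime_ge => //; exact: nearW.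
have lim_int : P.-integrable [set: borel (config e)] (fun w => limn (g^~ w)).
  apply/integrableP; split.
    by apply: (emeasurable_fun_cvg g) => // w _; exact: g_cvg.
  by under eq_integral do rewrite gee0_abs //.
have := integrable_ae measurableT lim_int.
apply: filterS => w /(_ I) /fineK lim_w; exists (fine (limn (g^~ w))) => k.
rewrite -lee_fin lim_w; apply: lime_ge; first exact: g_cvg.
by exists k => // l /= kl; exact: g_mono.
Qed.

Lemma joined_cluster_near (w : config e) x y : joined (subforest w) x y ->
  \forall k \near \oo, cluster_in (V_ k) w x y.
Proof.
case=> p; elim: p x => [x _ <-|[a z] p IH x]; first by apply: nearW => k; exact: joined_refl.
move=> [wa axz zp] py; near=> k; apply: joined_trans (near (IH _ zp py) k _) => //.
apply: (joined_edge (a := a)) => //; split=> //; near: k; exact: (exhaustion_near exhV).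
Unshelve. all: by end_near. Qed.

(* [s] is summable over the component of [x], hence bounded there. *)
Lemma bounded_cluster_summable (w : config e) x (M : R) :
  (forall k, cluster_weight s (V_ k) x w <= M) ->
  (\esum_(y in [set y | joined (subforest w) x y]) (s y ^+ 2)%:E < +oo)%E.
Proof.
move=> wM; have finite_le (A : {fset V}) :
    {in A, forall y, joined (subforest w) x y} -> \sum_(y <- A) s y <= M.
  move=> A_joined.
  have near_A : \forall k \near \oo, forall y : A, cluster_in (V_ k) w x (val y).
    by apply: filter_forall => y; apply/joined_cluster_near/A_joined/fsvalP.
  have [k [Vk Ak]] := filter_ex (filterI near_A (exhaustion_near exhV A)).
  apply: le_trans (wM k); apply: fset_sum_le => // y yA _.
  by rewrite (fsubsetP Ak) //=; apply/asboolP/(Vk [` yA]%fset).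
have s_le y : joined (subforest w) x y -> s y <= M.
  move=> xy; have := finite_le [fset y]%fset; rewrite big_seq_fset1; apply.
  by move=> z; rewrite inE => /eqP ->.
have M0 : 0 <= M by apply: le_trans (wM 0%N); exact: cluster_weight_ge0.
apply: le_lt_trans (ltry (M * M)); apply: ge_ereal_sup => _ [A [A_fin A_joined] <-].
rewrite fsbig_finite //= sumEFin lee_fin.
have A_in y : y \in fset_set A -> joined (subforest w) x y.
  by rewrite in_fset_set // inE => /A_joined.
(* The bound [M] on the sum is also a bound on each [s y], so [s y ^+ 2 <= M * s y]. *)
apply: (@le_trans _ _ (\sum_(y <- fset_set A) M * s y)).
  rewrite !big_seq; apply: ler_sum => y /A_in/s_le yM.
  by rewrite expr2 ler_wpM2r // ltW.
by rewrite -mulr_sumr ler_wpM2l // finite_le.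
Qed.

End WiredForest.

Theorem theorem1p1 (R : realType) (V : choiceType) (e : rel V)
    (e_sym : symmetric e) (e_irr : irreflexive e)
    (e_lf : locally_finite e) (e_conn : mconnected (graph_of e))
    (V_inf : infinite_set [set: V])
    (Gam : subgroup (aut e)) (Gam_closed : closed (subgroup_set Gam))
    (Gam_nonunimodular : ~ unimodular R Gam)
    (Gam_trans : transitive_on_vertices Gam)
    (mu : {measure set (borel (sub_aut Gam)) -> \bar R})
    (mu_haar : left_haar mu)
    (P : probability (borel (config e)) R) (P_wusf : is_wusf P) :
  {ae P, forall w : config e, forall T : set V,
    component (subforest w) T -> light mu T}.
Proof.
have [V_ exhV P_lim] := P_wusf.
have [enum enum_surj] := exhaustion_enum exhV V_inf.
have [d [psi [card_d psi_d s_exc]]] := excessive_root_mass e_sym e_lf e_conn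
  Gam_closed Gam_trans mu_haar enum_surj Gam_nonunimodular.
have s_gt0 := root_mass_gt0 e_sym e_lf e_conn Gam_closed Gam_trans mu_haar enum_surj.
(* There are countably many vertices, so one null set serves for all of them. *)
have : {ae P, forall w : config e, forall n,
    exists M, forall k, cluster_weight (root_mass mu) (V_ k) (enum n) w <= M}.
  apply: ae_foralln => n.
  exact: (wusf_cluster_weight_bounded e_sym e_irr e_lf V_inf exhV P_lim s_gt0
    card_d psi_d s_exc).
apply: (@filterS _ _ (ae_filter_ringOfSetsType P)) => w wM T [x _ ->].
have [n nx] := enum_surj x; have [M xM] := wM n; rewrite nx in xM.
have := bounded_cluster_summable exhV s_gt0 xM; rewrite /light.
rewrite (eq_esum (fun y _ => _ : _ = mass mu y)) // => y _.
by rewrite (mass_rmass e_sym e_lf e_conn Gam_closed mu_haar) root_mass_sq.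
Qed.
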